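(* For every choice of sufficiently smooth functions $r=r(s)$ and $t=t(s)$ (with $1-r't'\neq0$) there exists a function $h=h(s)$ such that the metric $$g=e^{2h}\Big(2(1-r't')\,ds\,(dz-p\,dx-q\,dy)+r'(dq-s\,dx-t\,dy)^2-2(dq-s\,dx-t\,dy)(dp-r\,dx-s\,dy)+t'(dp-r\,dx-s\,dy)^2\Big)$$ is Ricci flat. The function $h$ for which the metric $g$ is Ricci flat is a solution to the second order ODE $$h''=h'^2-\frac{(t'r')'}{1-r't'}h'+\frac{2\big(r^{(3)}t'+t^{(3)}r'\big)(1-r't')+2r''t''+4r't'r''t''+3t'^2r''^2+3r'^2t''^2}{8(1-r't')^2}.$$
   Context: Primes denote $d/ds$; $r^{(3)}=r'''$. $(x,y,z,p,q,s)$ are coordinates on the 6-dimensional jet space $\mathcal J$ of the system of PDEs $z_{xx}=r(z_{xy})$, $z_{yy}=t(z_{xy})$ ($p=z_x,q=z_y,s=z_{xy}$). Its 4-dimensional solution space is locally the leaf space $\mathcal S=\mathcal J/H^+$ of the integrable distribution $H^+$ spanned by $D_x=\partial_x+p\partial_z+r\partial_p+s\partial_q$ and $D_y=\partial_y+q\partial_z+s\partial_p+t\partial_q$. The bilinear form $g$ is degenerate exactly along $H^+$ and descends to a (conformal) metric on $\mathcal S$, of split signature if $1-r't'>0$ and Lorentzian signature if $1-r't'<0$; Ricci flatness refers to this 4-dimensional metric. The existence is local. *)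

(* Defs.v *)
From HB Require Import structures.
From mathcomp Require Import all_boot all_order all_algebra.
From mathcomp Require Import all_classical all_reals all_analysis.
Set Implicit Arguments.
Unset Strict Implicit.
Unset Printing Implicit Defensive.
Import Order.TTheory GRing.Theory Num.Theory.
Import numFieldNormedType.Exports.
Local Open Scope ring_scope.
Local Open Scope classical_set_scope.

(* f is of class C^k on U; meant for U open and V finite-dimensional. *)
Fixpoint class_C (R : realType) (V W : normedModType R) (k : nat) (U : set V)
    (f : V -> W) : Prop :=
  match k with
  | 0%N => forall x, U x -> {for x, continuous f}
  | k'.+1 => (forall x, U x -> differentiable f x) /\
             (forall v : V, class_C k' U ('D_v f))
  end.

Section RicciCurvature.
Context {R : realType} {n : nat}.
Implicit Types (G : 'rV[R]_n.+1 -> 'M[R]_n.+1) (x : 'rV[R]_n.+1).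

Definition partial (i : 'I_n.+1) (f : 'rV[R]_n.+1 -> R) x : R :=
  'D_(delta_mx 0 i) f x.

Definition pseudo_riemannian (V : set 'rV[R]_n.+1) G : Prop :=
  class_C 2 V G /\ forall x, V x -> (G x)^T = G x /\ G x \in unitmx.

Definition christoffel G (k i j : 'I_n.+1) x : R :=
  2^-1 * \sum_l invmx (G x) k l *
    (partial i (fun y => G y j l) x + partial j (fun y => G y i l) x
     - partial l (fun y => G y i j) x).

(* The component R^l_{kij}, where R(d_i, d_j) d_k = \sum_l R^l_{kij} d_l. *)
Definition riemann G (l k i j : 'I_n.+1) x : R :=
  partial i (christoffel G l j k) x - partial j (christoffel G l i k) x
  + \sum_m (christoffel G l i m x * christoffel G m j k x
            - christoffel G l j m x * christoffel G m i k x).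

Definition ricci G x : 'M[R]_n.+1 := \matrix_(j, k) \sum_i riemann G i k i j x.

End RicciCurvature.

(* Points of the jet space, and tangent vectors to it, are row vectors whose
   entries are taken in the order x, y, z, p, q, s. *)
Section JetSpace.
Context {R : realType}.
Implicit Types (r t h : R -> R) (u v w : 'rV[R]_6).

Definition cx u : R := u 0 (@Ordinal 6 0 isT).
Definition cy u : R := u 0 (@Ordinal 6 1 isT).
Definition cz u : R := u 0 (@Ordinal 6 2 isT).
Definition cp u : R := u 0 (@Ordinal 6 3 isT).
Definition cq u : R := u 0 (@Ordinal 6 4 isT).
Definition cs u : R := u 0 (@Ordinal 6 5 isT).

Definition Dx r u : 'rV[R]_6 :=
  \row_j [:: 1; 0; cp u; r (cs u); cs u; 0]`_j.
Definition Dy t u : 'rV[R]_6 :=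
  \row_j [:: 0; 1; cq u; cs u; t (cs u); 0]`_j.

Definition Hplus r t u : set 'rV[R]_6 :=
  [set v | exists a b : R, v = a *: Dx r u + b *: Dy t u].

(* The 1-forms dz - p dx - q dy, dp - r dx - s dy and dq - s dx - t dy. *)
Definition theta_z u v : R := cz v - cp u * cx v - cq u * cy v.
Definition theta_p r u v : R := cp v - r (cs u) * cx v - cs u * cy v.
Definition theta_q t u v : R := cq v - cs u * cx v - t (cs u) * cy v.

(* The symmetric product of two covectors. *)
Definition sym_prod (a b : 'rV[R]_6 -> R) v w : R :=
  2^-1 * (a v * b w + b v * a w).

Definition jet_form r t h u v w : R :=
  let s := cs u in
  expR (2 * h s) *
  (2 * (1 - derive1 r s * derive1 t s) * sym_prod cs (theta_z u) v w
   + derive1 r s * sym_prod (theta_q t u) (theta_q t u) v w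
   - 2 * sym_prod (theta_q t u) (theta_p r u) v w
   + derive1 t s * sym_prod (theta_p r u) (theta_p r u) v w).

(* The submersion pi identifies the open set V of R^4 with the space of leaves
   of the distribution H^+ restricted to U: ker d(pi) = H^+, so d(pi) has rank
   4 and the connected fibres of pi are exactly the leaves in U.
   'J pi u acts on row vectors from the right. *)
Definition leaf_space_chart r t (U : set 'rV[R]_6) (V : set 'rV[R]_4)
    (pi : 'rV[R]_6 -> 'rV[R]_4) : Prop :=
  [/\ open U /\ open V,
      pi @` U = V,
      class_C 3 U pi,
      (forall u, U u -> forall v, v *m 'J pi u = 0 <-> Hplus r t u v) &
      (forall u, U u -> connected (U `&` pi @^-1` [set pi u]))].

(* g = pi^* G on U. *)
Definition descends_to r t h (U : set 'rV[R]_6)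
    (pi : 'rV[R]_6 -> 'rV[R]_4) (G : 'rV[R]_4 -> 'M[R]_4) : Prop :=
  forall u, U u -> forall v w,
    jet_form r t h u v w =
    ((v *m 'J pi u) *m G (pi u) *m (w *m 'J pi u)^T) 0 0.

(* The metric which g induces on the leaf space of H^+, over the part s \in S of
   the jet space, is Ricci flat: near every point it is so in some chart of the
   (local) leaf space. *)
Definition ricci_flat_on_leaf_space r t h (S : set R) : Prop :=
  forall u0, S (cs u0) ->
    exists (U : set 'rV[R]_6) (V : set 'rV[R]_4)
      (pi : 'rV[R]_6 -> 'rV[R]_4) (G : 'rV[R]_4 -> 'M[R]_4),
    [/\ U u0 /\ (forall u, U u -> S (cs u)),
        leaf_space_chart r t U V pi,
        pseudo_riemannian V G,
        descends_to r t h U pi G &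
        forall y, V y -> ricci G y = 0].

Definition h_ode r t h (s : R) : Prop :=
  derive1n 2 h s =
    (derive1 h s) ^+ 2
    - derive1 (fun x => derive1 t x * derive1 r x) s / (1 - derive1 r s * derive1 t s) * derive1 h s
    + (2 * (derive1n 3 r s * derive1 t s + derive1n 3 t s * derive1 r s) * (1 - derive1 r s * derive1 t s)
       + 2 * derive1n 2 r s * derive1n 2 t s
       + 4 * derive1 r s * derive1 t s * derive1n 2 r s * derive1n 2 t s
       + 3 * (derive1 t s) ^+ 2 * (derive1n 2 r s) ^+ 2
       + 3 * (derive1 r s) ^+ 2 * (derive1n 2 t s) ^+ 2)
      / (8 * (1 - derive1 r s * derive1 t s) ^+ 2).

End JetSpace.

(* Main.v *)
Require Import Defs.
From mathcomp Require Import all_boot all_order all_algebra.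
From mathcomp Require Import all_classical all_reals all_analysis.
From mathcomp Require Import ring lra.
Import Order.TTheory GRing.Theory Num.Theory.
Import numFieldNormedType.Exports.
Local Open Scope ring_scope.
Local Open Scope classical_set_scope.
Set Implicit Arguments.
Unset Strict Implicit.
Unset Printing Implicit Defensive.

(** Along the leaves of H^+ the function s is constant, and a slice of constant
    x and y is transverse to the leaves. On such a slice, with coordinates
    z, p, q, s, the metric becomes

      e^{2h(s)} (2 (1 - r't') ds dz + t' dp^2 - 2 dp dq + r' dq^2),

    a plane wave in Rosen form. Its coefficients depend on s alone, and the only
    component of its Ricci tensor that is not identically zero is the ss one,
    which equals twice the difference of the two sides of the ODE for h
    (ricci_plane_wave). The Christoffel symbols that enter the computation are
    not derived from the inverse metric; they are recognized by the uniqueness of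
    the Levi-Civita connection (conn_unique).

    Necessity of the ODE (flat_h_ode). An arbitrary chart of the leaf space,
    restricted to the slice through a given point, is a map of class C^3 that
    pulls the Ricci-flat metric of the leaf space back to the plane wave. Since
    the Ricci tensor is natural under such maps (ricci_pullback), the plane wave
    is Ricci flat at that point, and its ss component gives the ODE. Naturality
    is proved in matrix form: the pulled back connection, corrected by the
    derivative of the Jacobian matrix J, is metric and torsion-free, hence equal
    to the Levi-Civita connection; the two connections are therefore related by
    the gauge transformation J, and the second derivatives of J drop out of the
    curvature because they are symmetric (schwarz).

    Sufficiency of the ODE (h_ode_flat). The solutions of z_xx = r(z_xy),
    z_yy = t(z_xy) with z_xy = s constant are quadratic polynomials in x and y, so
    that their values and first derivatives at x = y = 0, together with s, form an
    explicit global chart of the leaf space. In this chart the metric is again the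
    plane wave.

    Existence of h (h_ode_solvable). The substitution h = - ln w turns the ODE into
    a linear system with continuous coefficients, which is solved by Picard
    iteration (linear_system). *)

(** * Functions of class C^k *)

Section ClassC.
Context {R : realType}.
Implicit Types V W : normedModType R.

Lemma open_near (T : topologicalType) (U : set T) (P : T -> Prop) x :
  open U -> U x -> (forall y, U y -> P y) -> \near x, P x.
Proof.
by move=> oU Ux UP; apply: filterS UP _; exact: open_nbhs_nbhs.
Qed.

(** Differentiability, like the derivative, depends on the germ only. *)
Lemma near_eq_differentiable V W (f g : V -> W) x :
  (\near x, f x = g x) -> differentiable f x -> differentiable g x.
Proof.
move=> fg /diff_locallyP [dc df].
have fgx : f x = g x by exact: nbhs_singleton fg.
have e : g \o shift x = cst (g x) + 'd f x +o_ 0 id.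
  apply/eqaddoP => e e0.
  have fg0 : \forall z \near (0 : V), f (z + x) = g (z + x).
    by move: fg; rewrite (near_shift 0) subr0.
  move/eqaddoP : df => /(_ e e0); apply: filterS2 fg0.
  by move=> h; rewrite /= !fctE /= fgx => ->.
by apply/diff_locallyP; rewrite (diff_unique dc e).
Qed.

Lemma class_C_eq V W k (U : set V) (f g : V -> W) : open U ->
  (forall x, U x -> f x = g x) -> class_C k U f -> class_C k U g.
Proof.
move=> oU; elim: k f g => [|k IH] f g fg /=.
  move=> cf x Ux; suff : g y @[y --> x] --> g x by [].
  rewrite -fg //; apply: cvg_trans (cf _ Ux); apply: near_eq_cvg.
  by apply: (open_near oU Ux) => y /fg.
move=> [df cf]; split=> [x Ux|v].
  by apply: near_eq_differentiable (df x Ux); exact: (open_near oU Ux).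
apply: IH (cf v) => x Ux.
by apply: near_eq_derive; exact: (open_near oU Ux).
Qed.

Lemma class_C_diff V W k (U : set V) (f : V -> W) x :
  class_C k.+1 U f -> U x -> differentiable f x.
Proof. by case=> df _; exact: df. Qed.

Lemma class_C_derive V W k (U : set V) (f : V -> W) v :
  class_C k.+1 U f -> class_C k U ('D_v f).
Proof. by case=> _; exact. Qed.

Lemma class_CW V W k (U : set V) (f : V -> W) :
  class_C k.+1 U f -> class_C k U f.
Proof.
elim: k f => [|k IH] f [df cf] /=.
  by move=> x Ux; exact/differentiable_continuous/df.
by split=> // v; exact/IH/cf.
Qed.

Lemma class_C_subset V W k (U U' : set V) (f : V -> W) : U' `<=` U ->
  class_C k U f -> class_C k U' f.
Proof.
move=> sU; elim: k f => [|k IH] f /=; first by move=> cf x /sU /cf.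
by move=> [df cf]; split=> [x /sU/df //|v]; exact/IH/cf.
Qed.

Lemma class_C_cst V W k (U : set V) (a : W) : class_C k U (fun _ => a).
Proof.
elim: k a => [|k IH] a /=; first by move=> x _; exact: cst_continuous.
split=> [x _|v]; first exact: differentiable_cst.
rewrite (_ : 'D_v _ = fun _ => 0); first exact: IH.
by apply/funext => x; exact: derive_cst.
Qed.

Lemma class_C_id V k (U : set V) :
  class_C k U (fun x => x).
Proof.
case: k => [|k]; first by move=> x _; exact: cvg_id.
split=> [x _|v]; first exact: (@ex_diff _ _ _ _ _ _ _ (is_diff_id x)).
have -> : 'D_v (fun x : V => x) = fun=> v by apply/funext => x; exact: derive_id.
exact: class_C_cst.
Qed.

Lemma class_C0_continuous V W (f : V -> W) :
  class_C 0 setT f -> continuous f.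
Proof. by move=> cf x; exact: cf. Qed.

Lemma class_CD V W k (U : set V) (f g : V -> W) : open U ->
  class_C k U f -> class_C k U g -> class_C k U (fun x => f x + g x).
Proof.
move=> oU; elim: k f g => [|k IH] f g /=.
  by move=> cf cg x Ux; apply: cvgD; [exact: cf|exact: cg].
move=> [df cf] [dg cg]; split=> [x Ux|v].
  by apply: differentiableD; [exact: df|exact: dg].
apply: (class_C_eq oU) (IH _ _ (cf v) (cg v)) => x Ux.
by rewrite deriveD //; apply: diff_derivable; [exact: df|exact: dg].
Qed.

Lemma class_C_sum V W k (U : set V) (I : Type) (s : seq I) (f : I -> V -> W) :
  open U -> (forall i, class_C k U (f i)) ->
  class_C k U (fun x => \sum_(i <- s) f i x).
Proof.
move=> oU cf; elim: s => [|i s IH].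
  by apply: (class_C_eq oU) (class_C_cst _ _ 0) => x _; rewrite big_nil.
apply: (class_C_eq oU) (class_CD oU (cf i) IH) => x _.
by rewrite big_cons.
Qed.

Lemma class_CZl V W k (U : set V) (f : V -> R) (a : W) : open U ->
  class_C k U f -> class_C k U (fun x => f x *: a).
Proof.
move=> oU; elim: k f => [|k IH] f /=.
  by move=> cf x Ux; apply: cvgZr_tmp; exact: cf.
move=> [df cf]; split=> [x Ux|v]; first by apply: differentiableZl; exact: df.
apply: (class_C_eq oU) (IH _ (cf v)) => x Ux.
have dfx := df _ Ux.
by rewrite !deriveE ?diffZl //; exact: differentiableZl.
Qed.

Lemma class_CM V k (U : set V) (f g : V -> R) : open U ->
  class_C k U f -> class_C k U g -> class_C k U (fun x => f x * g x).
Proof.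
move=> oU; elim: k f g => [|k IH] f g.
  by move=> /= cf cg x Ux; apply: cvgM; [exact: cf|exact: cg].
move=> Cf Cg; have [df cf] := Cf; have [dg cg] := Cg; split=> [x Ux|v].
  by apply: differentiableM; [exact: df|exact: dg].
have := class_CD oU (IH _ _ (class_CW Cf) (cg v)) (IH _ _ (class_CW Cg) (cf v)).
apply: (class_C_eq oU) => x Ux.
by rewrite deriveM //; apply: diff_derivable; [exact: df|exact: dg].
Qed.

Lemma class_CN V k (U : set V) (f : V -> R) : open U ->
  class_C k U f -> class_C k U (fun x => - f x).
Proof.
move=> oU cf; apply: (class_C_eq oU) (class_CM oU (class_C_cst k U (-1 : R)) cf).
by move=> x _; rewrite mulN1r.
Qed.

Lemma class_CB V k (U : set V) (f g : V -> R) : open U ->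
  class_C k U f -> class_C k U g -> class_C k U (fun x => f x - g x).
Proof. by move=> oU cf cg; exact/(class_CD oU cf)/class_CN. Qed.

Lemma class_C_coord m n k (U : set 'M[R]_(m.+1, n.+1)) i j :
  class_C k U (fun M => M i j : R).
Proof.
case: k => [|k]; first by move=> x _; exact: coord_continuous.
split=> [x _|v]; first exact: differentiable_coord.
rewrite (_ : 'D_v _ = fun _ => v i j); first exact: class_C_cst.
apply/funext => x; have d : derivable id x v by exact: derivable_id.
by have := derive_mx d; rewrite derive_id => /matrixP /(_ i j); rewrite mxE.
Qed.

Lemma class_C_mxP V m n k (U : set V) (F : V -> 'M[R]_(m.+1, n.+1)) : open U ->
  class_C k U F <-> forall i j, class_C k U (fun x => F x i j).
Proof.
move=> oU; split=> [cF i j|cF].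
  elim: k F cF => [|k IH] F.
    move=> cF x Ux; apply: (@continuous_comp _ _ _ F (fun M => M i j)).
      exact: cF.
    exact: coord_continuous.
  move=> [dF cF]; split=> [x Ux|v].
    apply: (@differentiable_comp _ _ _ _ F (fun M => M i j)).
      exact: dF.
    exact: differentiable_coord.
  apply: (class_C_eq oU) (IH _ (cF v)) => x Ux.
  by rewrite derive_mx ?mxE //; apply: diff_derivable; exact: dF.
have := class_C_sum (index_enum 'I_m.+1) oU (fun i =>
  class_C_sum (index_enum 'I_n.+1) oU (fun j =>
   class_CZl (delta_mx i j) oU (cF i j))).
by apply: (class_C_eq oU) => x _; rewrite -matrix_sum_delta.
Qed.

(** Here A is the linear part of the affine map s. *)
Lemma derive_affine V V' W (f : V' -> W) (s A : V -> V') x v :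
  (forall h : R, s (h *: v + x) = h *: A v + s x) ->
  'D_v (f \o s) x = 'D_(A v) f (s x).
Proof.
move=> sA; rewrite /derive.
suff -> : (fun h : R => h^-1 *: (((f \o s) \o shift x) (h *: v) - (f \o s) x)) =
  (fun h : R => h^-1 *: ((f \o shift (s x)) (h *: A v) - f (s x))) by [].
by apply/funext => h /=; rewrite sA.
Qed.

Lemma class_C_affine V V' W k (U : set V') (f : V' -> W) (s A : V -> V') :
  (forall x, differentiable s x) ->
  (forall (h : R) v x, s (h *: v + x) = h *: A v + s x) ->
  class_C k U f -> class_C k (s @^-1` U) (f \o s).
Proof.
move=> ds sA; elim: k f => [|k IH] f /=.
  move=> cf x Ux; apply: continuous_comp; last exact: cf.
  exact: differentiable_continuous.
move=> [df cf]; split=> [x Ux|v].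
  by apply: differentiable_comp => //; exact: df.
rewrite (_ : 'D_v _ = ('D_(A v) f) \o s); first exact/IH/cf.
by apply/funext => x; exact: derive_affine.
Qed.

Lemma derive_comp1 V (g : R -> R) (f : V -> R) x v :
  differentiable f x -> differentiable g (f x) ->
  'D_v (g \o f) x = 'D_1 g (f x) * 'D_v f x.
Proof.
move=> df dg; rewrite !deriveE //; last exact: differentiable_comp.
rewrite diff_comp //= -[X in 'd g _ X]mulr1.
by rewrite -/(GRing.scale _ _) linearZ /= mulrC.
Qed.

Lemma class_C_comp V k (U : set V) (S : set R) (g : R -> R) (f : V -> R) :
  open U -> (forall x, U x -> S (f x)) ->
  class_C k S g -> class_C k U f -> class_C k U (g \o f).
Proof.
move=> oU fS; elim: k g f fS => [|k IH] g f fS.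
  by move=> /= cg cf x Ux; apply: continuous_comp; [exact: cf|exact/cg/fS].
move=> Cg Cf; have [dg cg] := Cg; have [df cf] := Cf; split=> [x Ux|v].
  by apply: differentiable_comp; [exact: df|exact/dg/fS].
have := class_CM oU (IH _ _ fS (cg 1) (class_CW Cf)) (cf v).
apply: (class_C_eq oU) => x Ux /=.
by rewrite derive_comp1 //; [exact: df|exact/dg/fS].
Qed.

(** For functions of one real variable the iterated derivative f^`() suffices. *)
Lemma class_C1P k (S : set R) (f : R -> R) : open S ->
  class_C k.+1 S f <->
  (forall x, S x -> differentiable f x) /\ class_C k S f^`().
Proof.
move=> oS; split=> -[df cf]; split=> //.
  have -> : f^`() = 'D_1 f by apply/funext => x; exact: derive1E.
  exact: cf.
move=> v.
apply: (class_C_eq oS) (class_CM oS (class_C_cst k S v) cf) => x Sx.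
rewrite derive1E !deriveE; try exact: df.
by rewrite -[in RHS](mulr1 v) -/(GRing.scale _ _) linearZ.
Qed.

Lemma class_C_is_derive k (S : set R) (f : R -> R) s :
  class_C k.+1 S f -> S s -> is_derive s 1 f (f^`() s).
Proof.
move=> cf Ss; have d := (derivable1_diffP f s).2 (class_C_diff cf Ss).
by apply: DeriveDef => //; rewrite derive1E.
Qed.

Lemma class_C_derive1 k (S : set R) (f : R -> R) :
  class_C k.+1 S f -> class_C k S f^`().
Proof.
move=> cf; have -> : f^`() = 'D_1 f by apply/funext => x; exact: derive1E.
exact: class_C_derive.
Qed.

Lemma class_C0_of_is_derive (S : set R) (f df : R -> R) :
  (forall s, S s -> is_derive s 1 f (df s)) -> class_C 0 S f.
Proof.
move=> dfd s Ss; apply: differentiable_continuous.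
by apply/derivable1_diffP; have [] := dfd s Ss.
Qed.

Lemma class_C_of_is_derive (S : set R) (f df : R -> R) k : open S ->
  (forall s, S s -> is_derive s 1 f (df s)) -> class_C k S df -> class_C k.+1 S f.
Proof.
move=> oS dfd cdf; apply: (class_C1P k f oS).2; split=> [s Ss|].
  by apply/derivable1_diffP; have [] := dfd s Ss.
apply: (class_C_eq oS) cdf => s Ss.
by rewrite derive1E; apply/esym; have [] := dfd s Ss.
Qed.

Lemma class_C_expR k (S : set R) : open S -> class_C k S expR.
Proof.
move=> oS; elim: k => [|k IH]; first by move=> x _; exact: continuous_expR.
apply/class_C1P => //; split=> [x _|].
  by apply/derivable1_diffP; exact: derivable_expR.
have -> : (expR : R -> R)^`() = expR.
  by apply/funext => x; rewrite derive1E; exact: derive_val.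
exact: IH.
Qed.

End ClassC.

Section ClassCAlgebra.
Context {R : realType} {V : normedModType R}.
Variables (k : nat) (U : set V).
Hypothesis oU : open U.

Lemma class_CV (f : V -> R) : (forall x, U x -> f x != 0) ->
  class_C k U f -> class_C k U (fun x => (f x)^-1).
Proof.
move=> f0; elim: k => [|m IH].
  by move=> /= cf x Ux; apply: cvgV; [exact: f0|exact: cf].
move=> Cf; have [df cf] := Cf; split=> [x Ux|v].
  by apply: differentiableV; [exact: df|exact: f0].
have c1 := IH (class_CW Cf).
apply: (class_C_eq oU) (class_CN oU (class_CM oU (class_CM oU c1 c1) (cf v))).
move=> x Ux; rewrite deriveV ?f0 //; last exact/diff_derivable/df.
by rewrite -mulNr /GRing.scale /= expr2 invfM.
Qed.

Lemma class_C_prod (I : Type) (s : seq I) (f : I -> V -> R) :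
  (forall i, class_C k U (f i)) -> class_C k U (fun x => \prod_(i <- s) f i x).
Proof.
move=> cf; elim: s => [|i s IH].
  by apply: (class_C_eq oU) (class_C_cst k U (1 : R)) => x _; rewrite big_nil.
apply: (class_C_eq oU) (class_CM oU (cf i) IH) => x _.
by rewrite big_cons.
Qed.

Lemma class_C_det n (F : V -> 'M[R]_n) :
  (forall i j, class_C k U (fun x => F x i j)) ->
  class_C k U (fun x => \det (F x)).
Proof.
move=> cF; apply: class_C_sum => // s; apply: class_CM => //.
  exact: class_C_cst.
exact: class_C_prod.
Qed.

Lemma class_C_inv n (F : V -> 'M[R]_n) :
  (forall x, U x -> F x \in unitmx) ->
  (forall i j, class_C k U (fun x => F x i j)) ->
  forall i j, class_C k U (fun x => invmx (F x) i j).
Proof.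
move=> uF cF i j.
have d0 x : U x -> \det (F x) != 0 by move=> /uF; rewrite unitmxE unitfE.
have cV := class_CV d0 (class_C_det cF).
have cA : class_C k U (fun x => \det (row' j (col' i (F x)))).
  apply: class_C_det => a b.
  by apply: (class_C_eq oU) (cF (lift j a) (lift i b)) => x _; rewrite !mxE.
apply: (class_C_eq oU) (class_CM oU cV
  (class_CM oU (class_C_cst k U ((-1) ^+ (j + i) : R)) cA)) => x Ux.
by rewrite /invmx uF // !mxE.
Qed.

End ClassCAlgebra.

(** * Symmetry of second derivatives *)

Section Schwarz.
Context {R : realType} {V : normedModType R}.

(** The derivative of f along a line is its directional derivative. *)
Lemma line_is_derive (f : V -> R) (a v : V) (s : R) :
  differentiable f (a + s *: v) ->
  is_derive s 1 (fun s' : R => f (a + s' *: v)) ('D_v f (a + s *: v)).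
Proof.
move=> df.
have e : (fun h : R => h^-1 *: (((fun s' : R => f (a + s' *: v)) \o shift s) (h *: 1) - f (a + s *: v)))
   = (fun h : R => h^-1 *: ((f \o shift (a + s *: v)) (h *: v) - f (a + s *: v))).
  apply/funext => h /=; congr (_ *: (f _ - _)).
  by rewrite [h *: 1]mulr1 scalerDl addrCA.
have D := @diff_derivable _ _ _ _ _ v df.
by split; [rewrite /derivable e|rewrite /derive e].
Qed.

(** Two applications of the mean value theorem write the second difference of f
    over a small parallelogram as a value of one mixed second derivative. *)
Lemma second_difference (f : V -> R) (U : set V) (a v w : V) (h : R) :
  0 < h ->
  (forall s t : R, 0 <= s <= h -> 0 <= t <= h -> U (a + s *: v + t *: w)) ->
  (forall x, U x -> differentiable f x) ->
  (forall x, U x -> differentiable ('D_v f) x) ->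
  exists s t : R, [/\ 0 <= s <= h, 0 <= t <= h &
    f (a + h *: v + h *: w) - f (a + h *: v) - (f (a + h *: w) - f a)
    = 'D_w ('D_v f) (a + s *: v + t *: w) * h * h].
Proof.
move=> h0 Ua df ddf.
have h00 : (0 : R) <= 0 <= h by rewrite lexx ltW.
have hh0 : (0 : R) <= h <= h by rewrite lexx ltW.
pose F (s : R) := f (a + h *: w + s *: v) - f (a + s *: v).
have dF s : 0 <= s <= h -> is_derive s 1 F
    ('D_v f (a + h *: w + s *: v) - 'D_v f (a + s *: v)).
  move=> sh; apply: is_deriveB; apply: line_is_derive; apply: df.
    by rewrite addrAC; exact: Ua.
  by have := Ua s 0 sh h00; rewrite scale0r addr0.
have [s sh Fs] : exists2 s, s \in `[0, h]%R &
    F h - F 0 = ('D_v f (a + h *: w + s *: v) - 'D_v f (a + s *: v)) * (h - 0).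
  apply: (MVT_segment (f := F) (df := fun s =>
    'D_v f (a + h *: w + s *: v) - 'D_v f (a + s *: v)) (ltW h0)).
    by move=> x; rewrite in_itv /= => /andP[x0 xh]; apply: dF; rewrite !ltW.
  apply: derivable_within_continuous => x; rewrite in_itv /= => xh.
  by have [] := dF _ xh.
have {}sh : 0 <= s <= h by rewrite in_itv in sh.
pose g (t : R) := 'D_v f (a + s *: v + t *: w).
have dg t : 0 <= t <= h -> is_derive t 1 g ('D_w ('D_v f) (a + s *: v + t *: w)).
  by move=> th; apply: line_is_derive; apply: ddf; exact: Ua.
have [t th gt] : exists2 t, t \in `[0, h]%R &
    g h - g 0 = 'D_w ('D_v f) (a + s *: v + t *: w) * (h - 0).
  apply: (MVT_segment (f := g) (df := fun t =>
    'D_w ('D_v f) (a + s *: v + t *: w)) (ltW h0)).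
    by move=> x; rewrite in_itv /= => /andP[x0 xh]; apply: dg; rewrite !ltW.
  apply: derivable_within_continuous => x; rewrite in_itv /= => xh.
  by have [] := dg _ xh.
exists s, t; split=> //.
move: Fs gt; rewrite /F /g !subr0 !scale0r !addr0 => Fs gt.
rewrite -gt [a + s *: v + h *: w]addrAC -Fs [a + h *: w + h *: v]addrAC.
move: (f (a + h *: v + h *: w)) (f (a + h *: v)) (f (a + h *: w)) (f a).
by move=> b c d e; ring.
Qed.

(** Both mixed derivatives represent the same second difference, so that they
    agree in the limit. *)
Lemma schwarz (U : set V) (f : V -> R) (v w x : V) : open U -> U x ->
  class_C 2 U f -> 'D_v ('D_w f) x = 'D_w ('D_v f) x.
Proof.
move=> oU Ux [df cf].
(* A property that holds near x holds on all small parallelograms at x. *)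
have sub2 (v' w' : V) (P : V -> Prop) : (\near x, P x) ->
    \forall h \near 0^'+, forall s t : R, 0 <= s <= h -> 0 <= t <= h ->
      P (x + s *: v' + t *: w').
  move=> /nbhs_ballP[e /= e0 eP].
  have M0 : 0 < `|v'| + `|w'| + 1 by rewrite ltr_wpDl // addr_ge0.
  near=> h => s t /andP[s0 sh] /andP[t0 th]; apply: eP.
  rewrite -ball_normE /= -addrA opprD addrA subrr add0r normrN.
  apply: le_lt_trans (ler_normD _ _) _; rewrite !normrZ !ger0_norm //.
  apply: (@le_lt_trans _ _ (h * (`|v'| + `|w'| + 1))).
    rewrite !mulrDr mulr1 -[leLHS]addr0; apply: lerD => //.
    by apply: lerD; apply: ler_wpM2r.
  rewrite -ltr_pdivlMr //; near: h.
  by apply: nbhs_right_lt; rewrite divr_gt0.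
apply/eqP; rewrite -subr_eq0; apply/eqP/normr0_eq0/le_anti.
rewrite normr_ge0 andbT; apply/ler_addgt0Pl => e e0; rewrite addr0.
have ce (a b : V) : \forall y \near x, `|'D_a ('D_b f) x - 'D_a ('D_b f) y| < e / 2.
  have [_ /(_ a) /= ca] := cf b.
  by move: (ca _ Ux) => /cvgrPdist_lt; apply; rewrite divr_gt0.
have nU : \forall y \near x, U y by exact: open_near Ux _.
have [h [h0 [Uvw [Uwv [Dvw Dwv]]]]] := filter_ex
  (filterI (@nbhs_right_gt R 0) (filterI (sub2 v w _ nU) (filterI (sub2 w v _ nU)
    (filterI (sub2 v w _ (ce w v)) (sub2 w v _ (ce v w)))))).
have [s [t [sh th st]]] := second_difference h0 Uvw df (cf v).1.
have [s' [t' [sh' th' st']]] := second_difference h0 Uwv df (cf w).1.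
have {}Dvw := Dvw s t sh th; have {}Dwv := Dwv s' t' sh' th'.
have E : 'D_w ('D_v f) (x + s *: v + t *: w) = 'D_v ('D_w f) (x + s' *: w + t' *: v).
  apply: (mulIf (lt0r_neq0 h0)); apply: (mulIf (lt0r_neq0 h0)).
  apply: etrans (esym st) (etrans _ st').
  rewrite [X in f X - f _ - _ = _]addrAC.
  move: (f (x + h *: w + h *: v)) (f (x + h *: v)) (f (x + h *: w)) (f x).
  by move=> a b c d; rewrite !opprB [LHS]addrACA [RHS]addrACA [- b - c]addrC.
rewrite -E in Dwv; apply: ltW; rewrite (splitr e).
apply: le_lt_trans (ltrD Dwv Dvw).
rewrite [X in _ <= _ + X]distrC; apply: le_trans (ler_normD _ _).
by rewrite subrKA.
Unshelve. all: by end_near. Qed.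

End Schwarz.

(** * Linear systems of ordinary differential equations *)

Section LinearODE.
Context {R : realType}.
Implicit Types f g : R -> R.

(** An antiderivative on the ball of radius 1, by the fundamental theorem of
    calculus. *)
Lemma antiderivative f (s0 : R) : continuous f ->
  exists F : R -> R, F s0 = 0 /\ forall x, `|x - s0| < 1 -> is_derive x 1 F (f x).
Proof.
move=> cf.
have intf : (@lebesgue_measure R).-integrable `[s0 - 2, s0 + 2] (EFin \o f).
  apply: continuous_compact_integrable; first exact: segment_compact.
  exact: continuous_subspaceT.
pose F x := (\int[@lebesgue_measure R]_(y in [set` `[s0 - 2, x]]) f y)%R.
exists (fun x => F x - F s0); split=> [|x]; first by rewrite subrr.
rewrite ltr_norml => /andP[x1 x2].
have [||dF dFE] := continuous_FTC1_closed (x := x) _ intf _ (cf x); [lra|lra|].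
have d : is_derive x 1 F (f x) := DeriveDef dF (etrans (esym (derive1E F x)) dFE).
by rewrite -[f x]subr0; apply: is_deriveB.
Qed.

Lemma mean_value_bound (H dH : R -> R) (s0 K x y : R) :
  (forall x, `|x - s0| < 1 -> is_derive x 1 H (dH x)) -> (forall x, `|dH x| <= K) ->
  `|x - s0| < 1 -> `|y - s0| < 1 -> `|H x - H y| <= K * `|x - y|.
Proof.
move=> dHH dHK.
wlog xy : x y / y <= x => [hw x1 y1|].
  have /orP[xy|xy] := le_total x y; last exact: hw.
  by rewrite distrC [`|x - y|]distrC; exact: hw.
move=> x1 y1.
have near1 z : z \in `[y, x]%R -> `|z - s0| < 1.
  rewrite in_itv /= => /andP[yz zx]; move: x1 y1; rewrite !ltr_norml.
  by move=> /andP[? ?] /andP[? ?]; apply/andP; split; lra.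
have cH : {within `[y, x], continuous H}.
  apply: derivable_within_continuous => z zxy.
  by have [] := dHH z (near1 z zxy).
have [z _ ->] := MVT_segment (f := H) (df := dH) xy
  (fun z zxy => dHH z (near1 z (subset_itv_oo_cc zxy))) cH.
by rewrite normrM; apply: ler_wpM2r.
Qed.

Lemma lipschitz_continuous f (M : R) :
  (forall x y, `|f x - f y| <= M * `|x - y|) -> continuous f.
Proof.
move=> fM x; apply/cvgrPdist_lt => e e0.
have M0 : 0 < `|M| + 1 by rewrite ltr_wpDl.
near=> y; apply: le_lt_trans (fM _ _) _.
apply: (@le_lt_trans _ _ ((`|M| + 1) * `|x - y|)).
  by apply: ler_wpM2r => //; rewrite (le_trans (ler_norm _)) // lerDl.
rewrite -ltr_pdivlMl // mulrC; near: y.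
apply: (@cvgr_dist_lt _ _ _ (nbhs x) _ id x) => //.
by rewrite divr_gt0.
Unshelve. all: by end_near. Qed.

Lemma le_geometric (c d k : R) : (forall n, c <= d + k * 4^-1 ^+ n) -> c <= d.
Proof.
move=> H.
have : (fun n => d + k * 4^-1 ^+ n) @ \oo --> d + k * 0.
  apply: cvgD; first exact: cvg_cst.
  apply: cvgM; first exact: cvg_cst.
  by apply: cvg_expr; rewrite ger0_norm ?invr_ge0 // invf_lt1 // ltr1n.
rewrite mulr0 addr0 => cv.
by apply: (cvgr_to_ge cv); apply: nearW => n; exact: H.
Qed.

(** The projection of the line onto the segment [s0 - e, s0 + e]. *)
Definition clamp (s0 e x : R) : R := Num.max (s0 - e) (Num.min (s0 + e) x).

Lemma clampP s0 e x : 0 <= e ->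
  [\/ clamp s0 e x = s0 - e /\ x <= s0 - e, clamp s0 e x = x /\ s0 - e <= x <= s0 + e |
      clamp s0 e x = s0 + e /\ s0 + e <= x].
Proof.
move=> e0; rewrite /clamp; have [xe|xe] := leP (s0 + e) x.
  by rewrite max_r; [apply: Or33|lra].
have [xe'|xe'] := leP (s0 - e) x.
  by apply: Or32; split=> //; apply/andP; split=> //; exact: ltW.
by apply: Or31; split=> //; exact: ltW.
Qed.

Lemma clamp_dist s0 e x : 0 <= e -> `|clamp s0 e x - s0| <= e.
Proof.
move=> e0; rewrite ler_norml; apply/andP.
by case: (clampP s0 x e0) => -[-> ?]; split; lra.
Qed.

Lemma clamp_lip s0 e x y : 0 <= e -> `|clamp s0 e x - clamp s0 e y| <= `|x - y|.
Proof.
move=> e0; wlog xy : x y / y <= x => [hw|].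
  have /orP[xy|xy] := le_total x y; last exact: hw.
  by rewrite distrC [`|x - y|]distrC; exact: hw.
rewrite [`|x - y|]ger0_norm ?subr_ge0 // ler_norml; apply/andP.
by case: (clampP s0 x e0) => -[-> ?]; case: (clampP s0 y e0) => -[-> ?]; split; lra.
Qed.

Lemma clamp_id s0 e x : `|x - s0| <= e -> clamp s0 e x = x.
Proof.
move=> xe; have e0 := le_trans (normr_ge0 _) xe.
by move: xe; rewrite ler_norml => /andP[? ?]; case: (clampP s0 x e0) => -[-> ?]; lra.
Qed.

(** Q f is the antiderivative of f that vanishes at s0, made constant outside of
    [s0 - e, s0 + e]; the freezing makes all of the estimates global. *)
Lemma integration_operator (s0 e : R) : 0 < e < 1 ->
  exists Q : (R -> R) -> R -> R,
  [/\ forall f g K, continuous f -> continuous g ->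
        (forall x, `|f x - g x| <= K) -> forall x, `|Q f x - Q g x| <= e * K,
      forall f M, continuous f -> (forall x, `|f x| <= M) ->
        forall x, `|Q f x| <= e * M,
      forall f M, continuous f -> (forall x, `|f x| <= M) ->
        forall x y, `|Q f x - Q f y| <= M * `|x - y| &
      forall f x, continuous f -> `|x - s0| < e -> is_derive x 1 (Q f) (f x)].
Proof.
move=> /andP[e0 e1].
have [P HP] : exists P : (R -> R) -> R -> R, forall f, continuous f ->
    P f s0 = 0 /\ forall x, `|x - s0| < 1 -> is_derive x 1 (P f) (f x).
  have H f : exists F : R -> R, continuous f -> F s0 = 0 /\
      forall x, `|x - s0| < 1 -> is_derive x 1 F (f x).
    have [cf|ncf] := pselect (continuous f); last by exists f.
    by have [F HF] := antiderivative s0 cf; exists F.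
  by exists (fun f => sval (cid (H f))) => f cf; exact: (svalP (cid (H f)) cf).
have s01 : `|s0 - s0| < 1 by rewrite subrr normr0.
have c1 x : `|clamp s0 e x - s0| < 1 by rewrite (le_lt_trans (clamp_dist _ _ (ltW e0))).
pose Q f x := P f (clamp s0 e x).
have Q1 f g K : continuous f -> continuous g ->
    (forall x, `|f x - g x| <= K) -> forall x, `|Q f x - Q g x| <= e * K.
  move=> cf cg fgK x; have [Pf0 dPf] := HP f cf; have [Pg0 dPg] := HP g cg.
  have := mean_value_bound (H := fun y => P f y - P g y) (dH := fun y => f y - g y)
    (s0 := s0) (K := K) _ fgK (c1 x) s01.
  rewrite Pf0 Pg0 subrr subr0 => H.
  apply: le_trans (H _) _ => [y y1|].
    by apply: is_deriveB; [exact: dPf|exact: dPg].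
  rewrite mulrC; apply: ler_wpM2r; first exact: le_trans (fgK 0).
  exact: clamp_dist (ltW e0).
have Q3 f M : continuous f -> (forall x, `|f x| <= M) ->
    forall x y, `|Q f x - Q f y| <= M * `|x - y|.
  move=> cf fM x y; have [_ dPf] := HP f cf.
  apply: le_trans (mean_value_bound dPf fM (c1 x) (c1 y)) _.
  apply: ler_wpM2l; first exact: le_trans (fM 0).
  exact: clamp_lip (ltW e0).
exists Q; split=> //.
- move=> f M cf fM x; have [Pf0 dPf] := HP f cf.
  have := mean_value_bound dPf fM (c1 x) s01; rewrite Pf0 subr0 => H.
  apply: le_trans H _; rewrite mulrC; apply: ler_wpM2r; first exact: le_trans (fM 0).
  exact: clamp_dist (ltW e0).
- move=> f x cf xe; have [_ dPf] := HP f cf.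
  apply: (@near_eq_is_derive _ _ _ (P f)); last by apply: dPf; exact: lt_trans e1.
  have : \forall y \near x, `|y - s0| < e.
    apply: (open_near (U := [set y | `|y - s0| < e])) => //.
    have -> : [set y | `|y - s0| < e] = ball s0 e.
      by apply/seteqP; split => y; rewrite -ball_normE /= distrC.
    exact: ball_open.
  by apply: filterS => y ye; rewrite /Q clamp_id // ltW.
Qed.

(** Picard iteration for the integral equations w = 1 + Q (a v), v = Q (b w),
    where Q is only known to have the estimates of an integration operator. As
    e M <= 1/2, the map T w = 1 + Q (a Q (b w)) contracts uniform distances by 1/4
    and preserves the set of functions at distance at most 1 from the constant 1;
    its values are even at distance at most 1/2 from 1, whence the positivity
    of w. *)
Lemma picard (a b : R -> R) (e M : R) (Q : (R -> R) -> R -> R) :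
  continuous a -> continuous b -> (forall x, `|a x| <= M) -> (forall x, `|b x| <= M) ->
  0 <= e -> e * M <= 2^-1 ->
  (forall f g K, continuous f -> continuous g ->
     (forall x, `|f x - g x| <= K) -> forall x, `|Q f x - Q g x| <= e * K) ->
  (forall f K, continuous f -> (forall x, `|f x| <= K) ->
     forall x, `|Q f x| <= e * K) ->
  (forall f K, continuous f -> (forall x, `|f x| <= K) ->
     forall x y, `|Q f x - Q f y| <= K * `|x - y|) ->
  exists w v : R -> R, [/\ continuous w, continuous v, forall x, 0 < w x,
    w = (fun x => 1 + Q (fun y => a y * v y) x) & v = Q (fun y => b y * w y)].
Proof.
move=> ca cb aM bM e0 eM Q1 Q2 Q3.
have M0 : 0 <= M by exact: le_trans (aM 0).
pose good f := continuous f /\ forall x, `|f x - 1| <= 1.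
pose V f := Q (fun y => b y * f y).
pose T f x := 1 + Q (fun y => a y * V f y) x.
have cM f g : continuous f -> continuous g -> continuous (fun y => f y * g y).
  by move=> cf cg x; apply: cvgM; [exact: cf|exact: cg].
have bf f : good f -> continuous (fun y => b y * f y) /\ forall x, `|b x * f x| <= M * 2.
  move=> [cf f1]; split; first exact: cM.
  move=> x; rewrite normrM; apply: ler_pM => //.
  by move: (f1 x); rewrite !ler_norml => /andP[? ?]; apply/andP; split; lra.
have VP f : good f -> continuous (V f) /\ forall x, `|V f x| <= 1.
  move=> gf; have [cbf bfM] := bf f gf; split.
    exact: lipschitz_continuous (Q3 _ _ cbf bfM).
  by move=> x; apply: le_trans (Q2 _ _ cbf bfM x) _; rewrite mulrA; lra.
have aV f : good f -> continuous (fun y => a y * V f y) /\ forall x, `|a x * V f x| <= M.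
  move=> gf; have [cV V1] := VP f gf; split; first exact: cM.
  by move=> x; rewrite normrM -[leRHS]mulr1; apply: ler_pM.
have Tlip f : good f -> forall x y, `|T f x - T f y| <= M * `|x - y|.
  move=> gf x y; have [cV V1] := aV f gf.
  by rewrite /T opprD addrACA subrr add0r; exact: Q3.
have T1 f : good f -> forall x, `|T f x - 1| <= 2^-1.
  move=> gf x; have [cV V1] := aV f gf.
  by rewrite /T addrAC subrr add0r; apply: le_trans (Q2 _ _ cV V1 x) _.
have goodT f : good f -> good (T f).
  move=> gf; split; first exact: lipschitz_continuous (Tlip f gf).
  by move=> x; apply: le_trans (T1 f gf x) _; lra.
have TT f g K : good f -> good g -> (forall x, `|f x - g x| <= K) ->
    forall x, `|T f x - T g x| <= 4^-1 * K.
  move=> gf gg fgK x; have K0 : 0 <= K by exact: le_trans (fgK 0).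
  have Vfg y : `|V f y - V g y| <= 2^-1 * K.
    apply: le_trans (Q1 _ _ (M * K) (bf f gf).1 (bf g gg).1 _ y) _.
      by move=> z; rewrite -mulrBr normrM; apply: ler_pM.
    by rewrite mulrA; apply: ler_wpM2r.
  rewrite /T opprD addrACA subrr add0r.
  apply: le_trans (Q1 _ _ (M * (2^-1 * K)) (aV f gf).1 (aV g gg).1 _ x) _.
    by move=> z; rewrite -mulrBr normrM; apply: ler_pM.
  rewrite mulrA (_ : 4^-1 * K = 2^-1 * (2^-1 * K)); last by field.
  by apply: ler_wpM2r => //; rewrite mulr_ge0.
pose w_ n := iter n T (fun=> 1).
have good_ n : good (w_ n).
  elim: n => [|n IH]; last exact: goodT.
  by split=> [x|x]; [exact: cst_continuous|rewrite subrr normr0].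
have dist_ m n x : `|w_ (n + m)%N x - w_ n x| <= 4^-1 ^+ n.
  elim: n x => [|n IH] x; first by rewrite add0n expr0; exact: (good_ m).2.
  by rewrite addSn exprS; exact: TT.
(* Since all later iterates stay within 4^-n of the n-th one, this supremum is
   their uniform limit. *)
pose w x := sup [set y | exists n, y = w_ n x - 4^-1 ^+ n].
have q0 n : 0 <= (4^-1 : R) ^+ n by rewrite exprn_ge0 // invr_ge0.
have ub n x : ubound [set y | exists n, y = w_ n x - 4^-1 ^+ n] (w_ n x + 4^-1 ^+ n).
  move=> _ [k ->]; have [nk|kn] := leqP n k.
    have := dist_ (k - n)%N n x; rewrite subnKC // ler_norml => /andP[_ ?].
    have := q0 k; lra.
  have := dist_ (n - k)%N k x; rewrite subnKC ?(ltnW kn) // ler_norml => /andP[? _].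
  have := q0 n; lra.
have w_dist n x : `|w x - w_ n x| <= 4^-1 ^+ n.
  rewrite ler_norml; apply/andP; split.
    rewrite -lerBlDr opprK addrC; apply: ub_le_sup; last by exists n; rewrite addrC.
    by exists (w_ 0%N x + 4^-1 ^+ 0); exact: ub.
  rewrite lerBlDr addrC; apply: ge_sup; last exact: ub.
  by exists (w_ n x - 4^-1 ^+ n), n.
have w_lip x y : `|w x - w y| <= M * `|x - y|.
  apply: (@le_geometric _ _ 2) => n.
  have := w_dist n.+1 x; have := w_dist n.+1 y; have := Tlip _ (good_ n) x y.
  have -> : T (w_ n) = w_ n.+1 by [].
  have : 4^-1 ^+ n.+1 <= (4^-1 : R) ^+ n.
    by rewrite exprS ler_piMl // invf_le1 // ler1n.
  move: (M * _) (4^-1 ^+ n.+1) (4^-1 ^+ n) (w x) (w y) (w_ n.+1 x) (w_ n.+1 y).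
  move=> A B C X Y X' Y' BC; rewrite !ler_norml => /andP[? ?] /andP[? ?] /andP[? ?].
  by apply/andP; split; lra.
have good_w : good w.
  split; first exact: lipschitz_continuous w_lip.
  by move=> x; have := w_dist 0%N x; rewrite expr0.
(* The limit is a fixed point, by comparison with the iterates. *)
have wT : T w = w.
  apply/funext => x; apply/eqP; rewrite -subr_eq0 -normr_le0.
  apply: (@le_geometric _ _ 1) => n.
  have := w_dist n.+1 x; have := TT w (w_ n) _ good_w (good_ n) (w_dist n) x.
  have -> : T (w_ n) = w_ n.+1 by [].
  have := q0 n; rewrite exprS.
  move: (4^-1 ^+ n) (T w x) (w x) (w_ n.+1 x) => C X Y Z C0.
  rewrite !ler_norml => /andP[? ?] /andP[? ?].
  by apply/andP; split; lra.
exists w, (V w); split=> //.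
- exact: good_w.1.
- exact: (VP w good_w).1.
- move=> x; have := T1 w good_w x; rewrite wT ler_norml => /andP[? _]; lra.
Qed.

(** Local solvability of w' = a v, v' = b w, with w positive. *)
Lemma linear_system (I : set R) (a b : R -> R) (s0 : R) : open I -> I s0 ->
  class_C 0 I a -> class_C 0 I b ->
  exists (S : set R) (w v : R -> R), [/\ open S /\ S s0, S `<=` I, forall s, 0 < w s,
    forall s, S s -> is_derive s 1 w (a s * v s) &
    forall s, S s -> is_derive s 1 v (b s * w s)].
Proof.
move=> oI Is0 ca cb.
pose M := `|a s0| + `|b s0| + 1.
have M0 : 0 < M by rewrite ltr_wpDl // addr_ge0.
have na : \forall x \near s0, `|a x| <= M.
  have := ca s0 Is0 => /cvgrPdist_le /(_ 1 ltr01); apply: filterS => x; rewrite distrC => H.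
  rewrite -[a x](subrK (a s0)) (le_trans (ler_normD _ _)) // /M.
  by have := normr_ge0 (b s0); lra.
have nb : \forall x \near s0, `|b x| <= M.
  have := cb s0 Is0 => /cvgrPdist_le /(_ 1 ltr01); apply: filterS => x; rewrite distrC => H.
  rewrite -[b x](subrK (b s0)) (le_trans (ler_normD _ _)) // /M.
  by have := normr_ge0 (a s0); lra.
have nI : \forall x \near s0, I x by exact: open_near Is0 _.
have /nbhs_ballP [d /= d0 dP] : \forall x \near s0, I x /\ (`|a x| <= M /\ `|b x| <= M).
  exact: filterI nI (filterI na nb).
(* The ball of radius e lies in I, and e < 1, e M <= 1/2 there. *)
pose e := Num.min (d / 2) (Num.min (2^-1) (2^-1 / M)).
have e0 : 0 < e.
  by rewrite /e !lt_min; apply/and3P; split; rewrite ?divr_gt0 ?invr_gt0.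
have ed : e < d.
  by rewrite (@le_lt_trans _ _ (d / 2)) ?ge_min ?lexx // ltr_pdivrMr // mulr2n mulrDr mulr1 ltrDl.
have e1 : e < 1.
  by rewrite (@le_lt_trans _ _ 2^-1) ?ge_min ?lexx ?orbT // invf_lt1 // ltr1n.
have eM : e * M <= 2^-1.
  by rewrite -ler_pdivlMr // !ge_min lexx !orbT.
pose c := clamp s0 e.
have cP x : I (c x) /\ (`|a (c x)| <= M /\ `|b (c x)| <= M).
  apply: dP; rewrite -ball_normE /= distrC.
  exact: le_lt_trans (clamp_dist _ _ (ltW e0)) ed.
have cc : continuous c.
  apply: (@lipschitz_continuous _ 1) => x y; rewrite mul1r; exact: clamp_lip (ltW e0).
have cac : continuous (fun x => a (c x)).
  by move=> x; apply: continuous_comp; [exact: cc|exact: ca (cP x).1].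
have cbc : continuous (fun x => b (c x)).
  by move=> x; apply: continuous_comp; [exact: cc|exact: cb (cP x).1].
have e01 : 0 < e < 1 by rewrite e0 e1.
have [Q [Q1 Q2 Q3 Q4]] := integration_operator s0 e01.
have [w [v [cw cv w0 wE vE]]] := picard cac cbc (fun x => (cP x).2.1) (fun x => (cP x).2.2)
  (ltW e0) eM Q1 Q2 Q3.
have cM f g : continuous f -> continuous g -> continuous (fun y => f y * g y).
  by move=> cf cg x; apply: cvgM; [exact: cf|exact: cg].
have cE s : `|s - s0| < e -> c s = s by move=> se; apply: clamp_id; exact: ltW.
exists (ball s0 e), w, v; split.
- by split; [exact: ball_open|exact: ballxx].
- move=> s; rewrite -ball_normE /= distrC => se.
  by apply: (dP s _).1; rewrite -ball_normE /= distrC; exact: lt_trans ed.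
- exact: w0.
- move=> s; rewrite -ball_normE /= distrC => se.
  have := Q4 _ s (cM _ _ cac cv) se; rewrite cE // => dQ.
  by rewrite {1}wE -[a s * v s]add0r; apply: is_deriveD.
- move=> s; rewrite -ball_normE /= distrC => se.
  by have := Q4 _ s (cM _ _ cbc cw) se; rewrite cE // {1}vE.
Qed.

End LinearODE.

(** * Calculus of matrix-valued functions *)

Section MatrixCalculus.
Context {R : realType} {n : nat}.
Local Notation E := 'rV[R]_n.+1.

(** The entrywise i-th partial derivative. *)
Definition mpartial p q (i : 'I_n.+1) (F : E -> 'M[R]_(p, q)) (x : E) : 'M[R]_(p, q) :=
  \matrix_(a, b) partial i (fun y => F y a b) x.

(** Entrywise differentiability. *)
Definition mdiff p q (F : E -> 'M[R]_(p, q)) (x : E) : Prop :=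
  forall a b, differentiable (fun y => F y a b) x.

Lemma partialD i (f g : E -> R) x : differentiable f x -> differentiable g x ->
  partial i (fun y => f y + g y) x = partial i f x + partial i g x.
Proof. by move=> df dg; apply: deriveD; exact: diff_derivable. Qed.

Lemma partialM i (f g : E -> R) x : differentiable f x -> differentiable g x ->
  partial i (fun y => f y * g y) x = partial i f x * g x + f x * partial i g x.
Proof.
move=> df dg; rewrite /partial deriveM; try exact: diff_derivable.
by rewrite addrC /GRing.scale /= [g x * _]mulrC.
Qed.

Lemma partial_sum i (I : Type) (s : seq I) (f : I -> E -> R) x :
  (forall j, differentiable (f j) x) ->
  differentiable (fun y => \sum_(j <- s) f j y) x /\
  partial i (fun y => \sum_(j <- s) f j y) x = \sum_(j <- s) partial i (f j) x.
Proof.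
move=> df; elim: s => [|j s [dIH IH]].
  rewrite big_nil; under eq_fun do rewrite big_nil.
  by split; [exact: differentiable_cst|exact: derive_cst].
rewrite big_cons; under eq_fun do rewrite big_cons.
split; first by apply: differentiableD => //; exact: df.
by rewrite partialD // IH.
Qed.

Lemma mdiffM p q r (F : E -> 'M[R]_(p, q)) (H : E -> 'M[R]_(q, r)) x :
  mdiff F x -> mdiff H x -> mdiff (fun y => F y *m H y) x.
Proof.
move=> dF dH a b; under eq_fun do rewrite mxE.
apply: (partial_sum ord0 _ _).1 => j.
by apply: differentiableM; [exact: dF|exact: dH].
Qed.

Lemma mpartialM p q r (F : E -> 'M[R]_(p, q)) (H : E -> 'M[R]_(q, r)) i x :
  mdiff F x -> mdiff H x ->
  mpartial i (fun y => F y *m H y) x = mpartial i F x *m H x + F x *m mpartial i H x.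
Proof.
move=> dF dH; apply/matrixP => a b; rewrite !mxE.
under [X in partial _ X]eq_fun do rewrite mxE.
rewrite (partial_sum i _ _).2; last first.
  by move=> j; apply: differentiableM; [exact: dF|exact: dH].
rewrite -big_split; apply: eq_bigr => j _ /=.
by rewrite partialM ?mxE; [|exact: dF|exact: dH].
Qed.

Lemma mpartial_tr p q (F : E -> 'M[R]_(p, q)) i x :
  mpartial i (fun y => (F y)^T) x = (mpartial i F x)^T.
Proof.
by apply/matrixP => a b; rewrite !mxE; congr partial; apply/funext => y; rewrite mxE.
Qed.

Lemma mdiff_tr p q (F : E -> 'M[R]_(p, q)) x :
  mdiff F x -> mdiff (fun y => (F y)^T) x.
Proof. by move=> dF a b; under eq_fun do rewrite mxE; exact: dF. Qed.

Lemma mpartialD p q (F H : E -> 'M[R]_(p, q)) i x :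
  mdiff F x -> mdiff H x ->
  mpartial i (fun y => F y + H y) x = mpartial i F x + mpartial i H x.
Proof.
move=> dF dH; apply/matrixP => a b; rewrite !mxE.
under [X in partial _ X]eq_fun do rewrite mxE.
by rewrite partialD; [|exact: dF|exact: dH].
Qed.

Lemma mpartial_near p q (F H : E -> 'M[R]_(p, q)) i x :
  (\forall y \near x, F y = H y) -> mpartial i F x = mpartial i H x.
Proof.
move=> FH; apply/matrixP => a b; rewrite !mxE.
by apply: near_eq_derive; apply: filterS FH => y ->.
Qed.

Lemma mpartial_sumZ p q (I : Type) (s : seq I) (f : I -> E -> R)
    (F : I -> E -> 'M[R]_(p, q)) i x :
  (forall j, differentiable (f j) x) -> (forall j, mdiff (F j) x) ->
  mdiff (fun y => \sum_(j <- s) f j y *: F j y) x /\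
  mpartial i (fun y => \sum_(j <- s) f j y *: F j y) x =
  \sum_(j <- s) (partial i (f j) x *: F j x + f j x *: mpartial i (F j) x).
Proof.
move=> df dF; have e a b : (fun y => (\sum_(j <- s) f j y *: F j y) a b) =
    (fun y => \sum_(j <- s) f j y * F j y a b).
  by apply/funext => y; rewrite summxE; apply: eq_bigr => j _; rewrite mxE.
have d j a b : differentiable (fun y => f j y * F j y a b) x.
  by apply: differentiableM; [exact: df|exact: dF].
split=> [a b|].
  by rewrite e; exact: (partial_sum ord0 _ (fun j => d j a b)).1.
apply/matrixP => a b; rewrite mxE e (partial_sum i _ (fun j => d j a b)).2.
rewrite summxE; apply: eq_bigr => j _; rewrite !mxE partialM //; exact: dF.
Qed.

Lemma partial_comp m (g : 'rV[R]_m.+1 -> R) (phi : E -> 'rV[R]_m.+1) i x :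
  differentiable phi x -> differentiable g (phi x) ->
  partial i (fun y => g (phi y)) x =
  \sum_a partial i (fun y => phi y 0 a) x * partial a g (phi x).
Proof.
move=> dp dg; rewrite /partial.
rewrite -[X in 'D__ X x]/(g \o phi).
rewrite deriveE; last exact: differentiable_comp.
rewrite diff_comp //.
transitivity ('d g (phi x) ('D_(delta_mx 0 i) phi x)); first by rewrite deriveE.
rewrite {1}(row_sum_delta ('D_(delta_mx 0 i) phi x)) linear_sum /=.
apply: eq_bigr => a _; rewrite linearZ /= -deriveE //; congr (_ * _).
by rewrite derive_mx ?mxE //; exact: diff_derivable.
Qed.

End MatrixCalculus.

(** * The Levi-Civita connection and its curvature *)

Section LeviCivita.
Context {R : realType} {n : nat}.
Local Notation E := 'rV[R]_n.+1.
Implicit Types (G : E -> 'M[R]_n.+1) (x : E).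

(** The connection matrix in the direction i: its (k, l) entry is the component
    l of the covariant derivative of the k-th coordinate field, so that it acts
    on row vectors. *)
Definition conn G (i : 'I_n.+1) x : 'M[R]_n.+1 := \matrix_(k, l) christoffel G l i k x.

(** The Christoffel symbols of the first kind. *)
Definition lower G (i : 'I_n.+1) x : 'M[R]_n.+1 := \matrix_(j, l)
  (2^-1 * (partial i (fun y => G y j l) x + partial j (fun y => G y i l) x
     - partial l (fun y => G y i j) x)).

Lemma connE G i x : (G x)^T = G x -> conn G i x = lower G i x *m invmx (G x).
Proof.
move=> sG; apply/matrixP => j k; rewrite !mxE /christoffel big_distrr /=.
apply: eq_bigr => l _.
rewrite !mxE.
have -> : invmx (G x) k l = invmx (G x) l k.
  by rewrite -[in RHS]sG -trmx_inv mxE.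
by rewrite mulrA mulrC mulrA mulrC [in RHS]mulrC [_ * 2^-1]mulrC.
Qed.

Section AtPoint.
Variables (G : E -> 'M[R]_n.+1) (x : E).
Hypothesis sG : \forall y \near x, (G y)^T = G y.
Hypothesis uG : G x \in unitmx.

Lemma partial_sym i j k :
  partial i (fun y => G y j k) x = partial i (fun y => G y k j) x.
Proof. by apply: near_eq_derive; apply: filterS sG => y e; rewrite -[in LHS]e mxE. Qed.

Lemma conn_lower i : conn G i x *m G x = lower G i x.
Proof. by rewrite connE ?mulmxKV //; exact: nbhs_singleton sG. Qed.

(** The connection preserves the metric. *)
Lemma conn_compat i :
  mpartial i G x = conn G i x *m G x + (conn G i x *m G x)^T.
Proof.
rewrite conn_lower; apply/matrixP => j k; rewrite !mxE.
rewrite (partial_sym i k j) (partial_sym j i k) (partial_sym k i j).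
rewrite (partial_sym j k i) (partial_sym k j i).
move: (partial i _ x) (partial j _ x) (partial k _ x) => a b c.
by field.
Qed.

(** The connection is torsion-free. *)
Lemma conn_sym i j l : conn G i x j l = conn G j x i l.
Proof.
rewrite !connE; try exact: nbhs_singleton sG.
rewrite !mxE; apply: eq_bigr => k _; rewrite !mxE; congr (_ * _ * _).
by rewrite (partial_sym k i j) [X in X - _]addrC.
Qed.

(** The fundamental theorem of Riemannian geometry at a point: a torsion-free
    and metric connection is the Levi-Civita connection. *)
Lemma conn_unique (C : 'I_n.+1 -> 'M[R]_n.+1) :
  (forall i j l, C i j l = C j i l) ->
  (forall i, mpartial i G x = C i *m G x + (C i *m G x)^T) ->
  forall i, C i = conn G i x.
Proof.
move=> sC cC i; rewrite connE; last exact: nbhs_singleton sG.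
suff <- : C i *m G x = lower G i x by rewrite mulmxK.
have sL a b c : (C a *m G x) b c = (C b *m G x) a c.
  by rewrite !mxE; apply: eq_bigr => l _; rewrite sC.
have pE a b c : partial a (fun y => G y b c) x = (C a *m G x) b c + (C a *m G x) c b.
  by have /matrixP/(_ b c) := cC a; rewrite mxE => ->; rewrite [LHS]mxE [X in _ + X]mxE.
apply/matrixP => j k; rewrite [RHS]mxE !pE.
rewrite (sL j i k) (sL j k i) (sL k i j).
move: ((C i *m G x) j k) ((C i *m G x) k j) ((C k *m G x) j i) => a b c.
by field.
Qed.

End AtPoint.

(** The curvature of a connection with matrices C i, in the directions i and j.
    The order of the factors in the commutator reflects the action of the
    matrices on row vectors. *)
Definition curv (C : 'I_n.+1 -> E -> 'M[R]_n.+1) i j x : 'M[R]_n.+1 :=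
  mpartial i (C j) x - mpartial j (C i) x + (C j x *m C i x - C i x *m C j x).

Lemma riemannE G l k i j x : riemann G l k i j x = curv (conn G) i j x k l.
Proof.
rewrite /riemann !mxE; congr (_ - _ + _).
- by congr partial; apply/funext => y; rewrite mxE.
- by congr partial; apply/funext => y; rewrite mxE.
rewrite -sumrB; apply: eq_bigr => m _.
by rewrite !mxE mulrC [X in _ - X]mulrC.
Qed.

Lemma ricciE G x j k : ricci G x j k = \sum_i curv (conn G) i j x k i.
Proof. by rewrite mxE; apply: eq_bigr => i _; rewrite riemannE. Qed.

Lemma class_C_christoffel (V : set E) G : open V -> pseudo_riemannian V G ->
  forall k i j, class_C 1 V (christoffel G k i j).
Proof.
move=> oV [cG GP] k i j.
have cG' a b : class_C 2 V (fun y => G y a b) by exact: (class_C_mxP 2 G oV).1.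
have cI := class_C_inv oV (fun x Vx => (GP x Vx).2) (fun a b => class_CW (cG' a b)).
have cp a b c : class_C 1 V (partial a (fun y => G y b c)).
  exact: class_C_derive (cG' b c).
apply: class_CM => //; first exact: class_C_cst.
apply: class_C_sum => // l; apply: class_CM => //.
by apply: class_CB => //; apply: class_CD.
Qed.

Lemma mdiff_conn (V : set E) G : open V -> pseudo_riemannian V G ->
  forall i x, V x -> mdiff (conn G i) x.
Proof.
move=> oV pG i x Vx a b; under eq_fun do rewrite mxE.
exact: class_C_diff (class_C_christoffel oV pG b i a) Vx.
Qed.

End LeviCivita.

(* Unification would otherwise unfold derivatives to limits. *)
#[local] Opaque derive.

(** * Naturality of the Ricci tensor *)

(** The Jacobian matrix acting on row vectors, as the matrix of partial
    derivatives. *)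
Definition jac (R : realType) n (phi : 'rV[R]_n.+1 -> 'rV[R]_n.+1) x : 'M[R]_n.+1 :=
  \matrix_(i, a) partial i (fun y => phi y 0 a) x.

Section GaugeAlgebra.
Context {R : realType} {n : nat}.
Local Notation M := 'M[R]_n.

(** The algebra behind the tensoriality of curvature: A, A' are connection
    matrices in two directions before, and P, P' after, the gauge
    transformation J; dA, dA', dP, dP' are their cross derivatives, B, B' the
    derivatives of J, and H its second derivative. *)
Lemma gauge_curv (J A A' dA dA' P P' dP dP' H B B' : M) :
  A *m J = B + J *m P -> A' *m J = B' + J *m P' ->
  dA' *m J + A' *m B = H + (B *m P' + J *m dP') ->
  dA *m J + A *m B' = H + (B' *m P + J *m dP) ->
  (dA' - dA + (A' *m A - A *m A')) *m J = J *m (dP' - dP + (P' *m P - P *m P')).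
Proof.
move=> eA eA' /(canRL (addrK _)) eD' /(canRL (addrK _)) eD.
rewrite !mulmxDl !mulNmx eD eD' -!mulmxA eA eA' !mulmxDr !mulmxN !mulmxA eA eA' !mulmxDl.
move: (B *m P') (J *m dP') (A' *m B) (B' *m P) (J *m dP) (A *m B')
  (J *m P' *m P) (J *m P *m P') => a b c d e f g h.
by apply/matrixP => u v; rewrite !mxE; ring.
Qed.

(** The curvature of a pulled back connection, with the direction vectors u and
    v, is the pulled back curvature; D a b is the derivative of C b in the
    direction a, and e the second derivative of the map. *)
Lemma gauge_sum (I : finType) (u v e : I -> R) (C : I -> M) (D : I -> I -> M) :
  \sum_a (e a *: C a + v a *: \sum_b u b *: D b a)
  - \sum_a (e a *: C a + u a *: \sum_b v b *: D b a)
  + ((\sum_a v a *: C a) *m (\sum_a u a *: C a)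
     - (\sum_a u a *: C a) *m (\sum_a v a *: C a)) =
  \sum_a \sum_b (u a * v b) *: (D a b - D b a + (C b *m C a - C a *m C b)).
Proof.
have sD (x y : I -> R) : \sum_a (e a *: C a + x a *: \sum_b y b *: D b a) =
    \sum_a e a *: C a + \sum_a \sum_b (x a * y b) *: D b a.
  rewrite big_split /=; congr (_ + _); apply: eq_bigr => a _.
  by rewrite scaler_sumr; apply: eq_bigr => b _; rewrite scalerA.
have sC (x y : I -> R) : (\sum_a x a *: C a) *m (\sum_a y a *: C a) =
    \sum_a \sum_b (x a * y b) *: (C a *m C b).
  rewrite mulmx_suml; apply: eq_bigr => a _.
  rewrite mulmx_sumr; apply: eq_bigr => b _.
  by rewrite -scalemxAl -scalemxAr scalerA.
have ex (F : I -> I -> M) : \sum_a \sum_b (v a * u b) *: F b a =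
    \sum_a \sum_b (u a * v b) *: F a b.
  rewrite exchange_big; apply: eq_bigr => a _; apply: eq_bigr => b _.
  by rewrite mulrC.
rewrite !sD !sC (ex D) (ex (fun a b => C b *m C a)).
rewrite [X in X - _ + _]addrC addrKA -!sumrB -big_split; apply: eq_bigr => a _ /=.
rewrite -!sumrB -big_split; apply: eq_bigr => b _ /=.
by rewrite !(scalerBr, scalerDr).
Qed.

Lemma sum_mul_inv (J : M) (N : 'I_n -> M) k : J \in unitmx ->
  \sum_i ((\sum_a J i a *: N a) *m invmx J) k i = \sum_a N a k a.
Proof.
move=> uJ; transitivity (\sum_a \sum_c N a k c * (invmx J *m J) c a).
  under eq_bigr do rewrite mulmx_suml summxE.
  rewrite exchange_big /=; apply: eq_bigr => a _.
  under eq_bigr do rewrite -scalemxAl !mxE big_distrr /=.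
  rewrite exchange_big /=; apply: eq_bigr => c _.
  rewrite mxE big_distrr /=; apply: eq_bigr => i _.
  by rewrite mulrCA [J i a * _]mulrC.
apply: eq_bigr => a _; rewrite mulVmx // (bigD1 a) //= mxE eqxx mulr1.
by rewrite big1 ?addr0 // => c /negPf ca; rewrite mxE ca mulr0.
Qed.

End GaugeAlgebra.

Section Pullback.
Context {R : realType} {n : nat}.
Local Notation E := 'rV[R]_n.+1.
Variables (Om V : set E) (phi : E -> E) (G G0 : E -> 'M[R]_n.+1).
Hypotheses (oO : open Om) (oV : open V) (phiV : forall x, Om x -> V (phi x)).
Hypotheses (cphi : class_C 3 Om phi).
Hypotheses (pG : pseudo_riemannian V G) (pG0 : pseudo_riemannian Om G0).

Local Notation J := (jac phi).

Hypothesis G0E : forall x, Om x -> G0 x = J x *m G (phi x) *m (J x)^T.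

Let cphia a : class_C 3 Om (fun y => phi y 0 a).
Proof. exact: (class_C_mxP 3 phi oO).1. Qed.

Let cJ i a : class_C 2 Om (fun x => J x i a).
Proof.
apply: (class_C_eq oO) (class_C_derive (delta_mx 0 i) (cphia a)) => x _.
by rewrite mxE.
Qed.

Let mdJ x : Om x -> mdiff J x.
Proof. by move=> Ox i a; exact: class_C_diff (cJ i a) Ox. Qed.

Let mdpJ i x : Om x -> mdiff (mpartial i J) x.
Proof.
move=> Ox j a; under eq_fun do rewrite mxE.
exact: class_C_diff (class_C_derive (delta_mx 0 i) (cJ j a)) Ox.
Qed.

Let dphi x : Om x -> differentiable phi x.
Proof. exact: class_C_diff cphi. Qed.

Let uJ x : Om x -> J x \in unitmx.
Proof.
by move=> Ox; have := (pG0.2 x Ox).2; rewrite G0E // !unitmx_mul => /andP[/andP[]].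
Qed.

Let J_sym x i j a : Om x -> mpartial i J x j a = mpartial j J x i a.
Proof.
move=> Ox.
have e k l : mpartial k J x l a = partial k (partial l (fun y => phi y 0 a)) x.
  by rewrite mxE; congr partial; apply/funext => y; rewrite mxE.
apply: etrans (e i j) (etrans _ (esym (e j i))).
exact: (schwarz (delta_mx 0 i) (delta_mx 0 j) oO Ox (class_CW (cphia a))).
Qed.

Let pJ_sym x i j : Om x ->
  mpartial i (mpartial j J) x = mpartial j (mpartial i J) x.
Proof.
move=> Ox; apply/matrixP => k a.
have e l m : mpartial l (mpartial m J) x k a = partial l (partial m (fun y => J y k a)) x.
  by rewrite mxE; congr partial; apply/funext => y; rewrite mxE.
apply: etrans (e i j) (etrans _ (esym (e j i))).
exact: (schwarz (delta_mx 0 i) (delta_mx 0 j) oO Ox (cJ k a)).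
Qed.

Let mpartial_phi p q (F : E -> 'M[R]_(p, q)) i x : Om x -> mdiff F (phi x) ->
  mpartial i (fun y => F (phi y)) x = \sum_a J x i a *: mpartial a F (phi x).
Proof.
move=> Ox dF; apply/matrixP => k l; rewrite mxE.
rewrite (partial_comp (g := fun y => F y k l)) ?summxE //; last exact: dphi.
by apply: eq_bigr => a _; rewrite !mxE.
Qed.

Let mdiff_phi p q (F : E -> 'M[R]_(p, q)) x : Om x -> mdiff F (phi x) ->
  mdiff (fun y => F (phi y)) x.
Proof.
move=> Ox dF a b.
apply: (@differentiable_comp _ _ _ _ phi (fun y => F y a b)); last exact: dF.
exact: dphi.
Qed.

Let mdG x : V x -> mdiff G x.
Proof. by move=> Vx a b; exact: class_C_diff ((class_C_mxP 2 G oV).1 pG.1 a b) Vx. Qed.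

Let symG : forall x, V x -> \forall y \near x, (G y)^T = G y.
Proof. by move=> x Vx; apply: open_near Vx _ => // y Vy; have [] := pG.2 y Vy. Qed.

Let symG0 : forall x, Om x -> \forall y \near x, (G0 y)^T = G0 y.
Proof. by move=> x Vx; apply: open_near Vx _ => // y Vy; have [] := pG0.2 y Vy. Qed.

(* The connection of G pulled back by phi, in the frame of the target. *)
Let pconn i x := \sum_a J x i a *: conn G a (phi x).

(* The right-hand side times J^-1 is a connection that is metric and
   torsion-free for G0, hence equal to conn G0. *)
Let conn_pullback i x : Om x ->
  conn G0 i x *m J x = mpartial i J x + J x *m pconn i x.
Proof.
move=> Ox; have Vx := phiV Ox; have uJx := uJ Ox.
have uG := (pG.2 _ Vx).2; have uG0 := (pG0.2 _ Ox).2.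
pose X j := mpartial j J x + J x *m pconn j x.
pose C j := X j *m invmx (J x).
suff <- : C i = conn G0 i x by rewrite /C mulmxKV.
apply: (conn_unique (symG0 Ox) uG0) => [j k l|j].
  rewrite !mxE; apply: eq_bigr => b _; congr (_ * _).
  have XE m l' : X m l' b = mpartial m J x l' b + (J x *m pconn m x) l' b.
    by rewrite /X mxE.
  apply: etrans (XE j k) (etrans _ (esym (XE k j))).
  congr (_ + _); first exact: J_sym.
  rewrite [LHS]mxE [RHS]mxE.
  under eq_bigr do rewrite summxE big_distrr /=.
  rewrite exchange_big /=; apply: eq_bigr => a _.
  rewrite summxE big_distrr /=; apply: eq_bigr => c _.
  rewrite [X in _ * X = _]mxE [X in _ = _ * X]mxE (conn_sym (symG Vx)).
  by rewrite !mulrA [_ * J x j a]mulrC.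
have -> : mpartial j G0 x = mpartial j (fun y => J y *m G (phi y) *m (J y)^T) x.
  apply: mpartial_near; exact: open_near Ox G0E.
have dGp := mdiff_phi Ox (mdG Vx).
rewrite mpartialM; last 2 first.
- exact: mdiffM (mdJ Ox) dGp.
- exact: mdiff_tr (mdJ Ox).
rewrite mpartialM //; last exact: mdJ.
rewrite mpartial_tr mpartial_phi //; last exact: mdG.
have -> : \sum_a J x j a *: mpartial a G (phi x) =
    pconn j x *m G (phi x) + (pconn j x *m G (phi x))^T.
  rewrite /pconn mulmx_suml linear_sum -big_split; apply: eq_bigr => a _ /=.
  by rewrite (conn_compat (symG Vx)) // -scalemxAl linearZ /= scalerDr.
have -> : C j *m G0 x = X j *m G (phi x) *m (J x)^T.
  by rewrite G0E // /C !mulmxA mulmxKV.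
have sG : (G (phi x))^T = G (phi x) by have [] := pG.2 _ Vx.
rewrite /X !trmx_mul trmxK !linearD /= !trmx_mul sG.
by rewrite !(mulmxDl, mulmxDr) !mulmxA !addrA [LHS]addrAC -!addrA; congr (_ + _);
  rewrite addrC -!addrA; congr (_ + _); rewrite addrC.
Qed.

Let mdpconn i x : Om x -> mdiff (pconn i) x /\
  forall j, mpartial j (pconn i) x =
    \sum_a (partial j (fun y => J y i a) x *: conn G a (phi x) +
      J x i a *: \sum_b J x j b *: mpartial b (conn G a) (phi x)).
Proof.
move=> Ox.
have dJ a : differentiable (fun y => J y i a) x by exact: mdJ.
have dC a : mdiff (fun y => conn G a (phi y)) x.
  by apply: mdiff_phi => //; exact: (mdiff_conn oV pG _ (phiV Ox)).
split=> [|j]; first exact: (mpartial_sumZ _ ord0 dJ dC).1.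
rewrite (mpartial_sumZ _ j dJ dC).2; apply: eq_bigr => a _.
by rewrite mpartial_phi //; exact: (mdiff_conn oV pG _ (phiV Ox)).
Qed.

Let curv_pullback i j x : Om x ->
  curv (conn G0) i j x *m J x =
  J x *m \sum_a \sum_b (J x i a * J x j b) *: curv (conn G) a b (phi x).
Proof.
move=> Ox.
have D k l : mpartial k (conn G0 l) x *m J x + conn G0 l x *m mpartial k J x =
    mpartial k (mpartial l J) x + (mpartial k J x *m pconn l x
      + J x *m mpartial k (pconn l) x).
  rewrite -mpartialM; [|exact: (mdiff_conn oO pG0)|exact: mdJ].
  rewrite -(mpartialM k (mdJ Ox) (mdpconn l Ox).1) -mpartialD //; first 1 last.
  - exact: mdpJ.
  - exact: mdiffM (mdJ Ox) (mdpconn l Ox).1.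
  by apply: mpartial_near; apply: open_near Ox _ => // y Oy; exact: conn_pullback.
apply: etrans (gauge_curv (conn_pullback i Ox) (conn_pullback j Ox) (D i j) _) _.
  by rewrite (pJ_sym i j Ox); exact: D.
congr (_ *m _).
have dp k l : mpartial k (pconn l) x =
    \sum_a (mpartial k J x l a *: conn G a (phi x) +
      J x l a *: \sum_b J x k b *: mpartial b (conn G a) (phi x)).
  rewrite (mdpconn l Ox).2; apply: eq_bigr => a _.
  by congr (_ *: _ + _); rewrite [RHS]mxE.
rewrite (dp i j) (dp j i).
under [X in _ - X + _]eq_bigr do rewrite (J_sym j i _ Ox).
exact: gauge_sum.
Qed.

(** The Ricci tensor is natural: if G0 is the pullback of G by phi, then ricci G0
    is the pullback of ricci G. The map phi need not be injective. *)
Lemma ricci_pullback x : Om x ->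
  ricci G0 x = J x *m ricci G (phi x) *m (J x)^T.
Proof.
move=> Ox; apply/matrixP => j k; rewrite ricciE.
pose L a := \sum_b J x j b *: curv (conn G) a b (phi x).
have cE i : curv (conn G0) i j x = (\sum_a J x i a *: (J x *m L a)) *m invmx (J x).
  rewrite -[LHS](mulmxK (uJ Ox)) curv_pullback // mulmx_sumr; congr (_ *m _).
  apply: eq_bigr => a _; rewrite scalemxAr; congr (_ *m _).
  by rewrite scaler_sumr; apply: eq_bigr => b _; rewrite scalerA.
under eq_bigr do rewrite cE.
rewrite sum_mul_inv; last exact: uJ.
transitivity (\sum_d \sum_b J x j b * ricci G (phi x) b d * J x k d); last first.
  rewrite mxE; apply: eq_bigr => d _; rewrite !mxE big_distrl /=.
  by apply: eq_bigr => b _.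
under eq_bigr do rewrite mxE; rewrite exchange_big; apply: eq_bigr => d _ /=.
under eq_bigr do rewrite summxE big_distrr /=; rewrite exchange_big; apply: eq_bigr => b _ /=.
rewrite ricciE big_distrr big_distrl /=; apply: eq_bigr => a _.
by rewrite [X in _ * X = _]mxE mulrC.
Qed.

End Pullback.

(** * Plane waves *)

Local Notation i0 := (@Ordinal 4 0 isT).
Local Notation i1 := (@Ordinal 4 1 isT).
Local Notation i2 := (@Ordinal 4 2 isT).
Local Notation i3 := (@Ordinal 4 3 isT).

Section Mx4.
Context {R : realType}.

(** The 4 x 4 matrix with the given rows; missing entries are 0. *)
Definition mx4 (l : seq (seq R)) : 'M[R]_4 := \matrix_(i, j) nth 0 (nth [::] l i) j.

Lemma sum4 (M : nmodType) (F : 'I_4 -> M) :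
  \sum_i F i = F i0 + F i1 + F i2 + F i3.
Proof.
rewrite !big_ord_recl big_ord0 addr0 !addrA.
by do !congr (_ + _); congr F; apply: val_inj.
Qed.

(** Case analysis on an index below 4, without leaving a variable. *)
Lemma ord4P (P : 'I_4 -> Prop) : P i0 -> P i1 -> P i2 -> P i3 -> forall i, P i.
Proof.
move=> P0 P1 P2 P3 [[|[|[|[|//]]]] hi];
 [move: P0|move: P1|move: P2|move: P3]; by congr P; apply: val_inj.
Qed.

(** The connection matrices of a metric 2 A ds dz + gamma_ab dX^a dX^b whose
    coefficients depend on s alone, in the coordinates z, X^1, X^2, s (a plane
    wave in Rosen form): a = A'/A, the k_ab are the entries of
    1/2 gamma' gamma^-1, and the g_ab those of - 1/2 gamma' / A. *)
Definition rosen (a k11 k12 k21 k22 g11 g12 g22 : R) (i : 'I_4) : 'M[R]_4 :=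
  mx4 (nth [::] [::
   [::];
   [:: [::]; [:: g11]; [:: g12]; [:: 0; k11; k12]];
   [:: [::]; [:: g12]; [:: g22]; [:: 0; k21; k22]];
   [:: [::]; [:: 0; k11; k12]; [:: 0; k21; k22]; [:: 0; 0; 0; a]]] i).

Lemma rosen_sym a k11 k12 k21 k22 g11 g12 g22 i j l :
  rosen a k11 k12 k21 k22 g11 g12 g22 i j l = rosen a k11 k12 k21 k22 g11 g12 g22 j i l.
Proof.
by move: i j l; do 3 apply: ord4P; rewrite !mxE.
Qed.

Lemma rosen0 i : rosen 0 0 0 0 0 0 0 0 i = 0.
Proof.
by apply/matrixP; move: i; do 3 apply: ord4P; rewrite !mxE.
Qed.

Lemma mpartial_rosen (a k11 k12 k21 k22 g11 g12 g22 : 'rV[R]_4 -> R) i j x :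
  mpartial i (fun w => rosen (a w) (k11 w) (k12 w) (k21 w) (k22 w) (g11 w) (g12 w) (g22 w) j) x =
  rosen (partial i a x) (partial i k11 x) (partial i k12 x) (partial i k21 x)
    (partial i k22 x) (partial i g11 x) (partial i g12 x) (partial i g22 x) j.
Proof.
have p0 : partial i (fun=> 0) x = 0 :> R by exact: derive_cst.
apply/matrixP; move: j; do 3 apply: ord4P; rewrite [LHS]mxE; under eq_fun do rewrite mxE /=;
  by rewrite [RHS]mxE /= ?p0.
Qed.

(** Multiplication by the metric with A = d, gamma_11 = p, gamma_22 = q and
    gamma_12 = -1. *)
Lemma rosen_mul a k11 k12 k21 k22 g11 g12 g22 d p q i :
  rosen a k11 k12 k21 k22 g11 g12 g22 i *m
    mx4 [:: [:: 0; 0; 0; d]; [:: 0; p; -1; 0]; [:: 0; -1; q; 0]; [:: d; 0; 0; 0]] =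
  mx4 (nth [::] [::
   [::];
   [:: [::]; [:: 0; 0; 0; g11 * d]; [:: 0; 0; 0; g12 * d]; [:: 0; k11 * p - k12; k12 * q - k11]];
   [:: [::]; [:: 0; 0; 0; g12 * d]; [:: 0; 0; 0; g22 * d]; [:: 0; k21 * p - k22; k22 * q - k21]];
   [:: [::]; [:: 0; k11 * p - k12; k12 * q - k11]; [:: 0; k21 * p - k22; k22 * q - k21];
     [:: a * d]]] i).
Proof.
apply/matrixP; move: i; do 3 apply: ord4P.
all: rewrite [RHS]mxE.
all: rewrite [LHS]mxE.
all: rewrite sum4.
all: rewrite !mxE /=.
all: try by rewrite ?(mul0r, mulr0, addr0, add0r).
all: ring.
Qed.

(** The Ricci tensor of a connection of this form whose coefficients depend on s
    alone, with s-derivatives da, dk11 and so on: only the ss component can be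
    nonzero. *)
Lemma ricci_rosen (a k11 k12 k21 k22 g11 g12 g22 da dk11 dk12 dk21 dk22 dg11 dg12 dg22 : R) :
  let C := rosen a k11 k12 k21 k22 g11 g12 g22 in
  let D (i : 'I_4) := if i == i3 then rosen da dk11 dk12 dk21 dk22 dg11 dg12 dg22 else fun=> 0 in
  forall j k : 'I_4,
  \sum_i (D i j - D j i + (C j *m C i - C i *m C j)) k i =
  (- (dk11 + dk22) + a * (k11 + k22) - (k11 ^+ 2 + 2 * k12 * k21 + k22 ^+ 2))
   *+ ((j == i3) && (k == i3)).
Proof.
move=> C D; do 2 apply: ord4P; rewrite sum4 /D /=;
  rewrite !mxE !sum4 /C !mxE /=; ring.
Qed.

Section OneVar.
Local Notation E := 'rV[R]_4.

Lemma partial_last (f : R -> R) i (w : E) : derivable f (w 0 i3) 1 ->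
  partial i (fun y => f (y 0 i3)) w = if i == i3 then f^`() (w 0 i3) else 0.
Proof.
move=> df; have dc : differentiable (fun y : E => y 0 i3) w by exact: differentiable_coord.
have dD : 'D_(delta_mx 0 i) (fun y : E => y 0 i3) w = (i == i3)%:R.
  have d : derivable id w (delta_mx 0 i : E) by exact: derivable_id.
  have := derive_mx d; rewrite derive_id => /matrixP /(_ 0 i3); rewrite [RHS]mxE => <-.
  by rewrite mxE eq_sym.
rewrite /partial -[X in derive X]/(f \o (fun y : E => y 0 i3)).
rewrite derive_comp1 //; last exact/derivable1_diffP.
by rewrite dD -derive1E; case: (i == i3); rewrite ?mulr1 ?mulr0.
Qed.

End OneVar.
End Mx4.

(* Closing tactics would otherwise unfold class_C. *)
#[local] Opaque class_C.

(** The metric e^{2h} (2 (1 - uv) ds dz + u dp^2 - 2 dp dq + v dq^2) in the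
    coordinates z, p, q, s. For u = t' and v = r' it is the metric of the
    theorem on a slice of constant x and y. *)
Definition plane_wave (R : realType) (u v h : R -> R) (w : 'rV[R]_4) : 'M[R]_4 :=
  let s := w 0 i3 in
  expR (2 * h s) *: mx4 [::
    [:: 0; 0; 0; 1 - v s * u s];
    [:: 0; u s; -1; 0];
    [:: 0; -1; v s; 0];
    [:: 1 - v s * u s; 0; 0; 0]].

(** The points of R^4 whose last coordinate is in S. *)
Definition slab (R : realType) (S : set R) : set 'rV[R]_4 := [set w | S (w 0 i3)].

Lemma open_slab (R : realType) (S : set R) : open S -> open (slab S).
Proof. by move=> oS; apply: open_comp oS => w _; exact: coord_continuous. Qed.

Lemma class_C_last (R : realType) (S : set R) k (f : R -> R) :
  open S -> class_C k S f -> class_C k (slab S) (fun w => f (w 0 i3)).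
Proof.
move=> oS cf; apply: (class_C_comp (S := S) (f := fun w : 'rV[R]_4 => w 0 i3)) => //.
  exact: open_slab.
exact: class_C_coord.
Qed.

Section PlaneWave.
Context {R : realType}.
Local Notation E := 'rV[R]_4.
Variables (S : set R) (u v h : R -> R).
Hypotheses (oS : open S) (cu : class_C 2 S u) (cv : class_C 2 S v) (ch : class_C 2 S h).
Local Notation D s := (1 - v s * u s).
Hypothesis D0 : forall s, S s -> D s != 0.
Local Notation G := (plane_wave u v h).
Local Notation Om := (slab S).
Local Notation u1 := (u^`()).
Local Notation v1 := (v^`()).
Local Notation h1 := (h^`()).

Let oOm : open Om. Proof. exact: open_slab. Qed.

Let cE : class_C 2 Om (fun w : E => expR (2 * h (w 0 i3))).
Proof.
apply: (class_C_comp (S := setT) (g := expR) oOm) => //; first exact: class_C_expR openT.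
by apply: class_CM => //; [exact: class_C_cst|exact: class_C_last].
Qed.

Let cD : class_C 2 Om (fun w : E => D (w 0 i3)).
Proof.
apply: (class_CB (f := fun=> 1) (g := fun w : E => v (w 0 i3) * u (w 0 i3)) oOm).
  exact: class_C_cst.
apply: (class_CM (f := fun w : E => v (w 0 i3)) oOm); exact: class_C_last.
Qed.

Lemma plane_wave_unit w : Om w -> G w \in unitmx.
Proof.
move=> Ow; set s := w 0 i3; have Ds : D s != 0 by exact: D0.
have e0 : expR (2 * h s) != 0 by rewrite lt0r_neq0 // expR_gt0.
suff /mulmx1_unit[] : G w *m ((expR (2 * h s))^-1 *: mx4 [::
    [:: 0; 0; 0; (D s)^-1];
    [:: 0; - v s / D s; - (D s)^-1; 0];
    [:: 0; - (D s)^-1; - u s / D s; 0];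
    [:: (D s)^-1; 0; 0; 0]]) = 1%:M by [].
rewrite /plane_wave -/s -scalemxAr -scalemxAl scalerA mulVf // scale1r.
move: (v s) (u s) Ds => a b d0.
by apply/matrixP; do 2 apply: ord4P; rewrite !mxE sum4 !mxE /=; field.
Qed.

Lemma plane_wave_pseudo : pseudo_riemannian Om G.
Proof.
split=> [|w Ow]; last split; last exact: plane_wave_unit.
  apply: (class_C_mxP 2 G oOm).2 => i j.
  have c0 : class_C 2 Om (fun _ : E => 0 : R) by exact: class_C_cst.
  have cN : class_C 2 Om (fun _ : E => -1 : R) by exact: class_C_cst.
  have cul := class_C_last oS cu; have cvl := class_C_last oS cv.
  rewrite /plane_wave; under eq_fun do rewrite mxE.
  apply: (class_CM oOm cE); move: i j.
  do 2 apply: ord4P.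
  by apply: (class_C_eq oOm) c0 => w _; rewrite mxE.
  by apply: (class_C_eq oOm) c0 => w _; rewrite mxE.
  by apply: (class_C_eq oOm) c0 => w _; rewrite mxE.
  by apply: (class_C_eq oOm) cD => w _; rewrite mxE.
  by apply: (class_C_eq oOm) c0 => w _; rewrite mxE.
  by apply: (class_C_eq oOm) cul => w _; rewrite mxE.
  by apply: (class_C_eq oOm) cN => w _; rewrite mxE.
  by apply: (class_C_eq oOm) c0 => w _; rewrite mxE.
  by apply: (class_C_eq oOm) c0 => w _; rewrite mxE.
  by apply: (class_C_eq oOm) cN => w _; rewrite mxE.
  by apply: (class_C_eq oOm) cvl => w _; rewrite mxE.
  by apply: (class_C_eq oOm) c0 => w _; rewrite mxE.
  by apply: (class_C_eq oOm) cD => w _; rewrite mxE.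
  by apply: (class_C_eq oOm) c0 => w _; rewrite mxE.
  by apply: (class_C_eq oOm) c0 => w _; rewrite mxE.
  by apply: (class_C_eq oOm) c0 => w _; rewrite mxE.
by apply/matrixP; do 2 apply: ord4P; rewrite !mxE.
Qed.

(** The connection of the metric plane_wave u v h, as a function of s. *)
Definition wave_conn i s : 'M[R]_4 := rosen
  (2 * h1 s - (v1 s * u s + v s * u1 s) / D s)
  (h1 s - u1 s * v s / (2 * D s)) (- u1 s / (2 * D s))
  (- v1 s / (2 * D s)) (h1 s - v1 s * u s / (2 * D s))
  (- 2^-1 * (2 * h1 s * u s + u1 s) / D s)
  (h1 s / D s)
  (- 2^-1 * (2 * h1 s * v s + v1 s) / D s) i.

Let du s : S s -> is_derive s 1 u (u1 s). Proof. exact: (class_C_is_derive cu). Qed.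
Let dv s : S s -> is_derive s 1 v (v1 s). Proof. exact: (class_C_is_derive cv). Qed.
Let dh s : S s -> is_derive s 1 h (h1 s). Proof. exact: (class_C_is_derive ch). Qed.

Let partial_wave (f : R -> R) i (w : E) df : is_derive (w 0 i3) 1 f df ->
  partial i (fun y : E => f (y 0 i3)) w = if i == i3 then df else 0.
Proof.
by move=> [d <-]; rewrite partial_last // derive1E.
Qed.

Let dE s : S s -> is_derive s 1 (fun s => expR (2 * h s)) (2 * h1 s * expR (2 * h s)).
Proof.
move=> Ss; have d2 : is_derive s 1 (fun s => 2 * h s) (2 * h1 s).
  exact: (@is_deriveZ _ _ _ h 2 s 1 (h1 s) (dh Ss)).
have := @is_derive1_comp _ expR (fun s => 2 * h s) s _ _ (is_derive_expR _) d2.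
by rewrite mulrC.
Qed.

Let dD s : S s -> is_derive s 1 (fun s => D s) (- (v1 s * u s + v s * u1 s)).
Proof.
move=> Ss; have := dv Ss; have := du Ss => du' dv'.
apply: is_derive_eq; rewrite /GRing.scale /=.
by move: (u s) (v s) (u^`() s) (v^`() s) => a b c d; ring.
Qed.

Let mpartial_entry i (w : E) a b (X : R -> R) dX : Om w ->
  (forall y, G y a b = expR (2 * h (y 0 i3)) * X (y 0 i3)) ->
  is_derive (w 0 i3) 1 X dX ->
  mpartial i G w a b =
  if i == i3 then let s := w 0 i3 in expR (2 * h s) * (2 * h1 s * X s + dX) else 0.
Proof.
move=> Ow GX dX'; rewrite mxE; under eq_fun do rewrite GX.
have de := dE Ow.
rewrite (partial_wave (f := fun s => expR (2 * h s) * X s) i (is_deriveM de dX')).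
by case: (i == i3) => //=; rewrite /GRing.scale /=; ring.
Qed.

Lemma mpartial_plane_wave i w : Om w -> mpartial i G w =
  if i == i3 then let s := w 0 i3 in let d := - (v1 s * u s + v s * u1 s) in
    expR (2 * h s) *: mx4 [::
    [:: 0; 0; 0; 2 * h1 s * D s + d];
    [:: 0; 2 * h1 s * u s + u1 s; 2 * h1 s * -1; 0];
    [:: 0; 2 * h1 s * -1; 2 * h1 s * v s + v1 s; 0];
    [:: 2 * h1 s * D s + d; 0; 0; 0]]
  else 0.
Proof.
move=> Ow; apply/matrixP => a b.
have c0 c : is_derive (w 0 i3) 1 (fun _ : R => c : R) 0 by exact: is_derive_cst.
have E a' b' (X : R -> R) dX : (forall y, G y a' b' = expR (2 * h (y 0 i3)) * X (y 0 i3)) ->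
  is_derive (w 0 i3) 1 X dX ->
  mpartial i G w a' b' =
  if i == i3 then let s := w 0 i3 in expR (2 * h s) * (2 * h1 s * X s + dX) else 0.
  exact: mpartial_entry.
have E0 a' b' : (forall y, G y a' b' = expR (2 * h (y 0 i3)) * 0) -> mpartial i G w a' b' = 0.
  move=> e; apply: etrans (E _ _ (fun=> 0) 0 e (c0 0)) _.
  by case: (i == i3) => //=; rewrite mulr0 addr0 mulr0.
have EN a' b' : (forall y, G y a' b' = expR (2 * h (y 0 i3)) * -1) -> mpartial i G w a' b' =
    if i == i3 then let s := w 0 i3 in expR (2 * h s) * (2 * h1 s * -1) else 0.
  move=> e; apply: etrans (E _ _ (fun=> -1) 0 e (c0 (-1))) _.
  by case: (i == i3) => //=; rewrite addr0.
have Eu := E _ _ u _ _ (du Ow); have Ev := E _ _ v _ _ (dv Ow).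
have ED := E _ _ (fun s => D s) _ _ (dD Ow).
move: a b; do 2 apply: ord4P.
  apply: etrans (E0 _ _ _) _ => [y|]; first by rewrite !mxE.
  by case: (i == i3); rewrite !mxE /= ?mulr0.
  apply: etrans (E0 _ _ _) _ => [y|]; first by rewrite !mxE.
  by case: (i == i3); rewrite !mxE /= ?mulr0.
  apply: etrans (E0 _ _ _) _ => [y|]; first by rewrite !mxE.
  by case: (i == i3); rewrite !mxE /= ?mulr0.
  apply: etrans (ED _ _ _) _ => [y|]; first by rewrite !mxE.
  by case: (i == i3); rewrite !mxE /= ?mulr0.
  apply: etrans (E0 _ _ _) _ => [y|]; first by rewrite !mxE.
  by case: (i == i3); rewrite !mxE /= ?mulr0.
  apply: etrans (Eu _ _ _) _ => [y|]; first by rewrite !mxE.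
  by case: (i == i3); rewrite !mxE /= ?mulr0.
  apply: etrans (EN _ _ _) _ => [y|]; first by rewrite !mxE.
  by case: (i == i3); rewrite !mxE /= ?mulr0.
  apply: etrans (E0 _ _ _) _ => [y|]; first by rewrite !mxE.
  by case: (i == i3); rewrite !mxE /= ?mulr0.
  apply: etrans (E0 _ _ _) _ => [y|]; first by rewrite !mxE.
  by case: (i == i3); rewrite !mxE /= ?mulr0.
  apply: etrans (EN _ _ _) _ => [y|]; first by rewrite !mxE.
  by case: (i == i3); rewrite !mxE /= ?mulr0.
  apply: etrans (Ev _ _ _) _ => [y|]; first by rewrite !mxE.
  by case: (i == i3); rewrite !mxE /= ?mulr0.
  apply: etrans (E0 _ _ _) _ => [y|]; first by rewrite !mxE.
  by case: (i == i3); rewrite !mxE /= ?mulr0.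
  apply: etrans (ED _ _ _) _ => [y|]; first by rewrite !mxE.
  by case: (i == i3); rewrite !mxE /= ?mulr0.
  apply: etrans (E0 _ _ _) _ => [y|]; first by rewrite !mxE.
  by case: (i == i3); rewrite !mxE /= ?mulr0.
  apply: etrans (E0 _ _ _) _ => [y|]; first by rewrite !mxE.
  by case: (i == i3); rewrite !mxE /= ?mulr0.
  apply: etrans (E0 _ _ _) _ => [y|]; first by rewrite !mxE.
  by case: (i == i3); rewrite !mxE /= ?mulr0.
Qed.

(** By uniqueness, only the two defining properties of the Levi-Civita connection
    have to be verified. *)
Lemma plane_wave_conn i w : Om w -> conn G i w = wave_conn i (w 0 i3).
Proof.
move=> Ow; apply/esym; move: i; apply: conn_unique.
- apply: (open_near oOm Ow) => y Oy; exact: (plane_wave_pseudo.2 y Oy).1.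
- exact: plane_wave_unit.
- by move=> i j l; exact: rosen_sym.
move=> i; rewrite mpartial_plane_wave //.
rewrite /plane_wave /wave_conn; set s := w 0 i3.
have := D0 Ow; rewrite -/s.
move: (u s) (v s) (h1 s) (u1 s) (v1 s) (expR (2 * h s)) => a b c da db e d0.
have trZ (A : 'M[R]_4) : (e *: A)^T = e *: A^T by apply/matrixP => k l; rewrite !mxE.
rewrite -scalemxAr rosen_mul trZ -scalerDr.
transitivity (e *: if i == i3 then mx4 [::
    [:: 0; 0; 0; 2 * c * (1 - b * a) - (db * a + b * da)];
    [:: 0; 2 * c * a + da; 2 * c * -1; 0];
    [:: 0; 2 * c * -1; 2 * c * b + db; 0];
    [:: 2 * c * (1 - b * a) - (db * a + b * da); 0; 0; 0]] else 0).
  by case: (i == i3); rewrite ?scaler0.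
congr (_ *: _); apply/matrixP; move: i; do 3 apply: ord4P.
all: rewrite [RHS]mxE [X in _ = _ + X]mxE /= ?mxE /=.
all: try by rewrite addr0.
all: by field.
Qed.

End PlaneWave.

Section PlaneWaveRicci.
Context {R : realType}.
Local Notation E := 'rV[R]_4.
Variables (S : set R) (u v h : R -> R).
Hypotheses (oS : open S) (cu : class_C 2 S u) (cv : class_C 2 S v) (ch : class_C 2 S h).
Local Notation D s := (1 - v s * u s).
Hypothesis D0 : forall s, S s -> D s != 0.
Local Notation G := (plane_wave u v h).
Local Notation Om := (slab S).
Local Notation u1 := (u^`()).
Local Notation v1 := (v^`()).
Local Notation h1 := (h^`()).

Let oOm : open Om. Proof. exact: open_slab. Qed.

Local Notation wave_conn := (wave_conn u v h).

(** The ss component is twice the difference of the two sides of the ODE for h. *)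
Lemma ricci_plane_wave w : Om w -> let s := w 0 i3 in
  forall j k, ricci G w j k =
  (2 * (h1 s ^+ 2 - (u1 s * v s + u s * v1 s) / D s * h1 s
    + (2 * (derive1 v1 s * u s + derive1 u1 s * v s) * D s + 2 * v1 s * u1 s
       + 4 * v s * u s * v1 s * u1 s + 3 * u s ^+ 2 * v1 s ^+ 2
       + 3 * v s ^+ 2 * u1 s ^+ 2) / (8 * D s ^+ 2)
    - derive1 h1 s)) *+ ((j == i3) && (k == i3)).
Proof.
move=> Ow s j k; have Ss : S s := Ow; have Ds := D0 Ss.
(* The coefficients of wave_conn, in the notation of rosen. *)
pose a (s : R) : R := 2 * h1 s - (v1 s * u s + v s * u1 s) / D s.
pose k11 (s : R) : R := h1 s - u1 s * v s / (2 * D s).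
pose k12 (s : R) : R := - u1 s / (2 * D s).
pose k21 (s : R) : R := - v1 s / (2 * D s).
pose k22 (s : R) : R := h1 s - v1 s * u s / (2 * D s).
pose g11 (s : R) : R := - 2^-1 * (2 * h1 s * u s + u1 s) / D s.
pose g12 (s : R) : R := h1 s / D s.
pose g22 (s : R) : R := - 2^-1 * (2 * h1 s * v s + v1 s) / D s.
have cu0 := class_CW cu; have cv0 := class_CW cv.
have cu1 := class_C_derive1 cu; have cv1 := class_C_derive1 cv.
have ch1 := class_C_derive1 ch.
have cc c : class_C 1 S (fun _ => c : R) by exact: class_C_cst.
have cDi : class_C 1 S (fun s => (D s)^-1).
  exact: (class_CV oS D0 (class_CB oS (cc 1) (class_CM oS cv0 cu0))).
have c2Di : class_C 1 S (fun s => (2 * D s)^-1).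
  apply: (class_C_eq oS) (class_CM oS (cc (2^-1)) cDi) => x _.
  by rewrite invfM.
have ca : class_C 1 S a.
  apply: (class_CB oS (class_CM oS (cc 2) ch1)).
  exact: (class_CM oS (class_CD oS (class_CM oS cv1 cu0) (class_CM oS cv0 cu1)) cDi).
have ck11 : class_C 1 S k11.
  exact: (class_CB oS ch1 (class_CM oS (class_CM oS cu1 cv0) c2Di)).
have ck12 : class_C 1 S k12 by exact: (class_CM oS (class_CN oS cu1) c2Di).
have ck21 : class_C 1 S k21 by exact: (class_CM oS (class_CN oS cv1) c2Di).
have ck22 : class_C 1 S k22.
  exact: (class_CB oS ch1 (class_CM oS (class_CM oS cv1 cu0) c2Di)).
have cg12 : class_C 1 S g12 by exact: (class_CM oS ch1 cDi).
have cg (f : R -> R) : class_C 2 S f ->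
    class_C 1 S (fun s : R => - 2^-1 * (2 * h1 s * f s + derive1 f s) / D s : R).
  move=> cf; apply: (class_CM oS (class_CM oS (cc _) _) cDi).
  exact: (class_CD oS (class_CM oS (class_CM oS (cc 2) ch1) (class_CW cf)) (class_C_derive1 cf)).
have cg11 : class_C 1 S g11 := cg u cu; have cg22 : class_C 1 S g22 := cg v cv.
have pE (f : R -> R) i : class_C 1 S f -> partial i (fun y : E => f (y 0 i3)) w = if i == i3 then derive1 f s else 0.
  by move=> cf; apply: partial_last; have [] := class_C_is_derive cf Ss.
pose C := rosen (a s) (k11 s) (k12 s) (k21 s) (k22 s) (g11 s) (g12 s) (g22 s).
pose dC (i : 'I_4) := if i == i3 then rosen (derive1 a s) (derive1 k11 s) (derive1 k12 s) (derive1 k21 s)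
  (derive1 k22 s) (derive1 g11 s) (derive1 g12 s) (derive1 g22 s) else fun=> 0.
have dCE i l : mpartial i (conn G l) w = dC i l.
  transitivity (mpartial i (fun y => wave_conn l (y 0 i3)) w).
    apply: mpartial_near; apply: (open_near oOm Ow) => y Oy; exact: (plane_wave_conn oS cu cv ch D0).
  rewrite mpartial_rosen (pE a i ca) (pE k11 i ck11) (pE k12 i ck12) (pE k21 i ck21)
    (pE k22 i ck22) (pE g11 i cg11) (pE g12 i cg12) (pE g22 i cg22) /dC.
  by case: (i == i3); rewrite ?rosen0.
have CE i : conn G i w = C i by exact: (plane_wave_conn oS cu cv ch D0).
transitivity (\sum_i (dC i j - dC j i + (C j *m C i - C i *m C j)) k i).
  by rewrite ricciE; apply: eq_bigr => i _; rewrite /curv !dCE !CE.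
rewrite /C /dC ricci_rosen; congr (_ *+ _).
have -> : derive1 k11 s + derive1 k22 s = 2 * derive1 h1 s
   - (derive1 u1 s * v s + 2 * u1 s * v1 s + derive1 v1 s * u s) / (2 * D s)
   - (u1 s * v s + v1 s * u s) ^+ 2 / (2 * D s ^+ 2).
  have := class_C_is_derive cu1 Ss; have := class_C_is_derive cv1 Ss => dv1 du1.
  have dh1 := class_C_is_derive ch1 Ss.
  have du := class_C_is_derive cu Ss; have dv := class_C_is_derive cv Ss.
  have dD : is_derive s 1 (fun s : R => 1 - v s * u s) (- (v1 s * u s + v s * u1 s)).
    apply: is_derive_eq; rewrite /GRing.scale /=.
    by move: (u s) (v s) (derive1 u s) (derive1 v s) => x1 x2 x3 x4; ring.
  have dDi : is_derive s 1 (fun s : R => (1 - v s * u s)^-1)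
      (D s ^- 2 * (v1 s * u s + v s * u1 s)).
    by have := is_deriveV (f := fun s : R => 1 - v s * u s) Ds dD; rewrite /GRing.scale /= mulrNN.
  have d2 : is_derive s 1 (fun s : R => (2 * (1 - v s * u s))^-1)
      (2^-1 * (D s ^- 2 * (v1 s * u s + v s * u1 s))).
    under eq_fun do rewrite invfM.
    exact: is_deriveZ.
  have dk11 := is_deriveB dh1 (is_deriveM (is_deriveM du1 dv) d2).
  have dk22 := is_deriveB dh1 (is_deriveM (is_deriveM dv1 du) d2).
  rewrite !derive1E (@derive_val _ _ _ _ _ _ _ dk11) (@derive_val _ _ _ _ _ _ _ dk22).
  rewrite /GRing.scale /= -!derive1E.
  rewrite -[(u1 * v) s]/(u1 s * v s) -[(v1 * u) s]/(v1 s * u s).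
  move: (u s) (v s) (h1 s) (u1 s) (v1 s) (derive1 h1 s) (derive1 u1 s) (derive1 v1 s) Ds.
  by move=> x1 x2 x3 x4 x5 x6 x7 x8 d0; field.
rewrite /a /k11 /k12 /k21 /k22.
move: (u s) (v s) (h1 s) (u1 s) (v1 s) (derive1 h1 s) (derive1 u1 s) (derive1 v1 s) Ds.
by move=> x1 x2 x3 x4 x5 x6 x7 x8 d0; field.
Qed.

End PlaneWaveRicci.

(** * The slices of constant x and y *)

Section Slice.
Context {R : realType}.

Lemma ord6P (P : 'I_6 -> Prop) : P (@Ordinal 6 0 isT) -> P (@Ordinal 6 1 isT) ->
  P (@Ordinal 6 2 isT) -> P (@Ordinal 6 3 isT) -> P (@Ordinal 6 4 isT) ->
  P (@Ordinal 6 5 isT) -> forall i, P i.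
Proof.
move=> P0 P1 P2 P3 P4 P5 [[|[|[|[|[|[|//]]]]]] hi];
 [move: P0|move: P1|move: P2|move: P3|move: P4|move: P5]; by congr P; apply: val_inj.
Qed.

Definition jet (x y z p q s : R) : 'rV[R]_6 := \row_j [:: x; y; z; p; q; s]`_j.

Lemma jetE (u : 'rV[R]_6) : u = jet (cx u) (cy u) (cz u) (cp u) (cq u) (cs u).
Proof. by apply/rowP; apply: ord6P; rewrite mxE. Qed.

Lemma jet_coord x y z p q s : let u := jet x y z p q s in
  [/\ cx u = x, cy u = y, cz u = z, cp u = p & cq u = q /\ cs u = s].
Proof. by rewrite /= /cx /cy /cz /cp /cq /cs !mxE. Qed.

(** The slice x = x0, y = y0, which is transverse to H^+. *)
Definition slice (x0 y0 : R) (w : 'rV[R]_4) : 'rV[R]_6 :=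
  jet x0 y0 (w 0 i0) (w 0 i1) (w 0 i2) (w 0 i3).

Lemma slice_affine x0 y0 (k : R) (v w : 'rV[R]_4) :
  slice x0 y0 (k *: v + w) = k *: slice 0 0 v + slice x0 y0 w.
Proof. by apply/rowP; apply: ord6P; rewrite !mxE /= ?mulr0 ?add0r. Qed.

Lemma class_C_slice k (U : set 'rV[R]_4) x0 y0 : open U -> class_C k U (slice x0 y0).
Proof.
move=> oU; apply: (class_C_mxP k (slice x0 y0) oU).2 => i j.
have cc c : class_C k U (fun _ : 'rV[R]_4 => c : R) by exact: class_C_cst.
have cw l : class_C k U (fun w : 'rV[R]_4 => w 0 l : R) by exact: class_C_coord.
move: j; apply: ord6P.
- by apply: (class_C_eq oU) (cc x0) => w _; rewrite !mxE.
- by apply: (class_C_eq oU) (cc y0) => w _; rewrite !mxE.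
- by apply: (class_C_eq oU) (cw i0) => w _; rewrite !mxE.
- by apply: (class_C_eq oU) (cw i1) => w _; rewrite !mxE.
- by apply: (class_C_eq oU) (cw i2) => w _; rewrite !mxE.
- by apply: (class_C_eq oU) (cw i3) => w _; rewrite !mxE.
Qed.

Lemma jet_form_slice (r t h : R -> R) x0 y0 w i j :
  jet_form r t h (slice x0 y0 w) (slice 0 0 (delta_mx 0 i)) (slice 0 0 (delta_mx 0 j)) =
  plane_wave (derive1 t) (derive1 r) h w i j.
Proof.
rewrite /jet_form /sym_prod /theta_z /theta_p /theta_q /cs /cx /cy /cz /cp /cq !mxE /=.
rewrite !(mulr0, subr0).
move: (derive1 r _) (derive1 t _) (expR _) => a b e.
move: i j; do 2 apply: ord4P; rewrite ?mxE /=; by field.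
Qed.

Lemma pseudo_riemannianS n (U V : set 'rV[R]_n.+1) (G : 'rV[R]_n.+1 -> 'M[R]_n.+1) :
  U `<=` V -> pseudo_riemannian V G -> pseudo_riemannian U G.
Proof. by move=> UV [cG GP]; split; [exact: class_C_subset cG|move=> x /UV /GP]. Qed.

Lemma jac_slice (pi : 'rV[R]_6 -> 'rV[R]_4) x0 y0 w i :
  differentiable pi (slice x0 y0 w) ->
  row i (jac (pi \o slice x0 y0) w) = slice 0 0 (delta_mx 0 i) *m 'J pi (slice x0 y0 w).
Proof.
move=> dpi.
have ds : differentiable (slice x0 y0) w.
  exact: class_C_diff (class_C_slice 1 x0 y0 openT) I.
rewrite -deriveEjacobian // -(derive_affine pi (s := slice x0 y0) (A := slice 0 0)); last first.
  by move=> k; rewrite slice_affine.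
rewrite derive_mx; last by apply: diff_derivable; exact: differentiable_comp.
by apply/rowP => a; rewrite !mxE.
Qed.

Lemma mulmx_form m n p (A : 'M[R]_(m, n)) (B : 'M[R]_n) (C : 'M[R]_(p, n)) i j :
  (A *m B *m C^T) i j = (row i A *m B *m (row j C)^T) 0 0.
Proof.
rewrite -row_mul tr_row mxE [RHS]mxE; apply: eq_bigr => k _.
by rewrite !mxE.
Qed.

(** A chart of the leaf space restricts to a map of class C^3 on the slice
    through u0, and pulls the metric of the leaf space back to plane_wave. *)
Lemma ricci_flat_slice (r t h : R -> R) (S : set R) (u0 : 'rV[R]_6) : open S ->
  class_C 2 S (derive1 t) -> class_C 2 S (derive1 r) -> class_C 2 S h ->
  (forall s, S s -> 1 - derive1 r s * derive1 t s != 0) ->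
  ricci_flat_on_leaf_space r t h S -> S (cs u0) ->
  ricci (plane_wave (derive1 t) (derive1 r) h)
    (\row_j [:: cz u0; cp u0; cq u0; cs u0]`_j) = 0.
Proof.
move=> oS ct cr ch D0 flat Su0; have [U [V [pi [G [[Uu0 US] chart pG desc ric0]]]]] := flat u0 Su0.
have [[oU oV] piUV cpi _ _] := chart.
set w0 : 'rV[R]_4 := \row_j _.
set sg := slice (cx u0) (cy u0).
have sg0 : sg w0 = u0.
  by rewrite [RHS]jetE /sg /slice !mxE.
pose Om : set 'rV[R]_4 := sg @^-1` U.
have dsg w : differentiable sg w.
  exact: class_C_diff (class_C_slice 1 (cx u0) (cy u0) openT) I.
have oO : open Om.
  by apply: open_comp oU => w _; exact: differentiable_continuous.
have OS : Om `<=` slab S.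
  by move=> w /US; rewrite /cs mxE.
have pG0 := pseudo_riemannianS OS (plane_wave_pseudo oS ct cr ch D0).
have cphi : class_C 3 Om (pi \o sg).
  apply: (class_C_affine (A := slice 0 0) dsg _ cpi) => k v x.
  exact: slice_affine.
have phiV w : Om w -> V ((pi \o sg) w).
  by move=> Ow; rewrite -piUV; exists (sg w).
have O0 : Om w0 by rewrite /Om /= sg0.
rewrite (ricci_pullback oO oV phiV cphi pG pG0 _ O0).
  by rewrite ric0 ?mulmx0 ?mul0mx //; exact: phiV.
move=> w Ow; apply/matrixP => i j.
rewrite -(jet_form_slice r t h (cx u0) (cy u0)) (desc _ Ow) [RHS]mulmx_form.
have dpi := class_C_diff cpi Ow.
have js := jac_slice (x0 := cx u0) (y0 := cy u0) (w := w) _ dpi.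
by rewrite (js i) (js j).
Qed.

(** The ODE in the form in which it appears in ricci_plane_wave. *)
Lemma h_odeE (r t h : R -> R) (s : R) :
  is_derive s 1 (derive1 r) (derive1 (derive1 r) s) ->
  is_derive s 1 (derive1 t) (derive1 (derive1 t) s) ->
  let u := derive1 t in let v := derive1 r in let D := 1 - v s * u s in
  h_ode r t h s <->
  derive1 h s ^+ 2 - (derive1 u s * v s + u s * derive1 v s) / D * derive1 h s
    + (2 * (derive1 (derive1 v) s * u s + derive1 (derive1 u) s * v s) * D
       + 2 * derive1 v s * derive1 u s
       + 4 * v s * u s * derive1 v s * derive1 u s + 3 * u s ^+ 2 * derive1 v s ^+ 2
       + 3 * v s ^+ 2 * derive1 u s ^+ 2) / (8 * D ^+ 2)
    - derive1 (derive1 h) s = 0.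
Proof.
move=> dr dt u v D.
have dM := is_deriveM dt dr.
have e : derive1 (fun x => u x * v x) s = derive1 u s * v s + u s * derive1 v s.
  rewrite derive1E; apply: etrans (@derive_val _ _ _ _ _ _ _ dM) _.
  by rewrite /GRing.scale /= addrC [derive1 r s * _]mulrC.
rewrite /h_ode e.
split=> [H|/eqP]; last by rewrite subr_eq0 => /eqP.
by apply/eqP; rewrite subr_eq0 -H.
Qed.

(** Necessity of the ODE. *)
Lemma flat_h_ode (r t h : R -> R) (S : set R) : open S ->
  class_C 2 S (derive1 t) -> class_C 2 S (derive1 r) -> class_C 2 S h ->
  (forall s, S s -> 1 - derive1 r s * derive1 t s != 0) ->
  ricci_flat_on_leaf_space r t h S -> forall s, S s -> h_ode r t h s.
Proof.
move=> oS ct cr ch D0 flat s Ss.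
have [cx_ cy_ cz_ cp_ [cq_ cs_]] := jet_coord 0 0 0 0 0 s.
have Su : S (cs (jet 0 0 0 0 0 s)) by rewrite cs_.
have := ricci_flat_slice oS ct cr ch D0 flat Su.
rewrite cz_ cp_ cq_ cs_; set w := \row_j _ => ric0.
have w3 : w 0 i3 = s by rewrite mxE.
have Ow : slab S w by rewrite /slab /= w3.
have := ricci_plane_wave oS ct cr ch D0 Ow i3 i3.
rewrite ric0 w3 [LHS]mxE eqxx mulr1n => /esym/eqP.
rewrite mulf_eq0 pnatr_eq0 /= => /eqP e.
apply: (h_odeE h _ _).2 e.
  exact: class_C_is_derive cr Ss.
exact: class_C_is_derive ct Ss.
Qed.

End Slice.

(** * An explicit chart of the leaf space *)

Section Chart.
Context {R : realType}.
Local Notation J := 'rV[R]_6.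
Variables (S : set R) (r t : R -> R).
Hypotheses (oS : open S) (cr : class_C 3 S r) (ct : class_C 3 S t).

(** Together with s, the values at x = y = 0 of z, p and q on the solution of
    z_xx = r(s), z_xy = s, z_yy = t(s) through the jet u: s is constant on
    solutions, which are therefore quadratic polynomials. *)
Definition first_integral_z (u : J) : R :=
  cz u - cp u * cx u - cq u * cy u
  + 2^-1 * (r (cs u) * cx u * cx u + 2 * cs u * cx u * cy u + t (cs u) * cy u * cy u).
Definition first_integral_p (u : J) : R := cp u - r (cs u) * cx u - cs u * cy u.
Definition first_integral_q (u : J) : R := cq u - cs u * cx u - t (cs u) * cy u.

(** The projection onto the leaf space. *)
Definition leaf (u : J) : 'rV[R]_4 :=
  \row_j [:: first_integral_z u; first_integral_p u; first_integral_q u; cs u]`_j.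

(** The jets with s in S. *)
Definition jet_slab : set J := [set u | S (cs u)].

Lemma open_jet_slab : open jet_slab.
Proof. by apply: open_comp oS => w _; exact: coord_continuous. Qed.
Let oU := open_jet_slab.

Lemma leaf_jet x y z p q s : leaf (jet x y z p q s) =
  \row_j [:: z - p * x - q * y + 2^-1 * (r s * x * x + 2 * s * x * y + t s * y * y);
             p - r s * x - s * y; q - s * x - t s * y; s]`_j.
Proof.
have [ex ey ez ep [eq es]] := jet_coord x y z p q s.
by rewrite /leaf /first_integral_z /first_integral_p /first_integral_q ex ey ez ep eq es.
Qed.

(** The point over (x, y) of the leaf w. *)
Definition leaf_point (w : 'rV[R]_4) (x y : R) : J :=
  let z := w 0 i0 in let p := w 0 i1 in let q := w 0 i2 in let s := w 0 i3 in
  jet x y (z + p * x + q * y + 2^-1 * (r s * x * x + 2 * s * x * y + t s * y * y))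
    (p + r s * x + s * y) (q + s * x + t s * y) s.

Lemma leaf_pointK w x y : leaf (leaf_point w x y) = w.
Proof.
rewrite leaf_jet; apply/rowP; apply: ord4P; rewrite mxE /=.
all: by field.
Qed.

Lemma leaf_point_leaf u : leaf_point (leaf u) (cx u) (cy u) = u.
Proof.
rewrite [RHS]jetE /leaf_point !mxE /= /first_integral_z /first_integral_p /first_integral_q.
move: (cx u) (cy u) (cz u) (cp u) (cq u) (cs u) => x y z p q s.
move: (r s) (t s) => a b.
by congr jet; field.
Qed.

Lemma leaf_image : leaf @` jet_slab = slab S.
Proof.
apply/seteqP; split=> [_ [u Su <-]|w Sw]; first by rewrite /slab /= mxE.
exists (leaf_point w 0 0); last exact: leaf_pointK.
rewrite /jet_slab /=; suff -> : cs (leaf_point w 0 0) = w 0 i3 by [].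
by rewrite /leaf_point; have [_ _ _ _ [_ ->]] := jet_coord 0 0 (w 0 i0 + w 0 i1 * 0 + w 0 i2 * 0 + 2^-1 * (r (w 0 i3) * 0 * 0 + 2 * w 0 i3 * 0 * 0 + t (w 0 i3) * 0 * 0))
    (w 0 i1 + r (w 0 i3) * 0 + w 0 i3 * 0) (w 0 i2 + w 0 i3 * 0 + t (w 0 i3) * 0) (w 0 i3).
Qed.

Lemma leaf_point_continuous (u : J) :
  continuous (fun k : R => leaf_point (leaf u) (k * cx u) (k * cy u)).
Proof.
have oT : open [set: R] by exact: openT.
have cc c : class_C 0 setT (fun _ : R => c : R) by exact: class_C_cst.
have ci : class_C 0 [set: R] (fun k : R => k).
  exact: class_C_id.
have cm c : class_C 0 [set: R] (fun k : R => k * c) by exact: class_CM.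
apply: class_C0_continuous.
apply: (class_C_mxP 0 _ oT).2 => i j.
move: (leaf u) => w; move: (cx u) (cy u) => x y.
have cz' : class_C 0 setT (fun k : R => w 0 i0 + w 0 i1 * (k * x) + w 0 i2 * (k * y) +
   2^-1 * (r (w 0 i3) * (k * x) * (k * x) + 2 * w 0 i3 * (k * x) * (k * y) +
   t (w 0 i3) * (k * y) * (k * y))).
  have := class_CD oT (class_CD oT (class_CD oT (cc (w 0 i0)) (class_CM oT (cc (w 0 i1)) (cm x)))
    (class_CM oT (cc (w 0 i2)) (cm y))) (class_CM oT (cc 2^-1)
     (class_CD oT (class_CD oT (class_CM oT (class_CM oT (cc (r (w 0 i3))) (cm x)) (cm x))
       (class_CM oT (class_CM oT (cc (2 * w 0 i3)) (cm x)) (cm y)))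
       (class_CM oT (class_CM oT (cc (t (w 0 i3))) (cm y)) (cm y)))).
  exact.
have cl a b c : class_C 0 setT (fun k : R => a + b * (k * x) + c * (k * y)).
  exact: (class_CD oT (class_CD oT (cc a) (class_CM oT (cc b) (cm x))) (class_CM oT (cc c) (cm y))).
move: j; apply: ord6P.
- by apply: (class_C_eq oT) (cm x) => k _; rewrite mxE.
- by apply: (class_C_eq oT) (cm y) => k _; rewrite mxE.
- by apply: (class_C_eq oT) cz' => k _; rewrite mxE.
- by apply: (class_C_eq oT) (cl (w 0 i1) (r (w 0 i3)) (w 0 i3)) => k _; rewrite mxE.
- by apply: (class_C_eq oT) (cl (w 0 i2) (w 0 i3) (t (w 0 i3))) => k _; rewrite mxE.
- by apply: (class_C_eq oT) (cc (w 0 i3)) => k _; rewrite mxE.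
Qed.

(** Leaves are graphs over the (x, y)-plane, hence star-shaped. *)
Lemma leaf_connected u : jet_slab u -> connected (jet_slab `&` leaf @^-1` [set leaf u]).
Proof.
move=> Uu.
set F := _ `&` _.
pose c (v : J) (k : R) := leaf_point (leaf v) (k * cx v) (k * cy v).
have -> : F = \bigcup_(v in F) (c v @` setT).
  apply/seteqP; split=> [v Fv|v [v' [Uv' lv'] [k _ <-]]].
    exists v => //; exists 1 => //; rewrite /c !mul1r; exact: leaf_point_leaf.
  have lc : leaf (c v' k) = leaf v' by exact: leaf_pointK.
  split; last by rewrite /= lc.
  have := congr1 (fun w : 'rV[R]_4 => w 0 i3) lc; rewrite !mxE /= => e.
  by rewrite /jet_slab /= e.
apply: bigcup_connected => [|v Fv].
  exists (leaf_point (leaf u) 0 0) => v [_ lv].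
  by exists 0 => //; rewrite /c !mul0r lv.
apply: connected_continuous_connected.
  by apply/connected_intervalP => x y _ _ z.
by apply: continuous_subspaceT; exact: leaf_point_continuous.
Qed.

Let ccoord k i : class_C k jet_slab (fun u : J => u 0 i).
Proof. exact: class_C_coord. Qed.

Let cfun k (f : R -> R) : class_C k S f -> class_C k jet_slab (fun u => f (cs u)).
Proof. by move=> cf; exact: (class_C_comp (f := cs) oU (fun x Sx => Sx) cf (ccoord k _)). Qed.

Lemma class_C_leaf : class_C 3 jet_slab leaf.
Proof.
apply: (class_C_mxP 3 leaf oU).2 => i j.
have cc c : class_C 3 jet_slab (fun _ : J => c : R) by exact: class_C_cst.
have crs := cfun cr; have cts := cfun ct.
have cX : class_C 3 jet_slab (cx : J -> R) := ccoord 3 _.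
have cY : class_C 3 jet_slab (cy : J -> R) := ccoord 3 _.
have cZ : class_C 3 jet_slab (cz : J -> R) := ccoord 3 _.
have cP : class_C 3 jet_slab (cp : J -> R) := ccoord 3 _.
have cQ : class_C 3 jet_slab (cq : J -> R) := ccoord 3 _.
have cS : class_C 3 jet_slab (cs : J -> R) := ccoord 3 _.
have fz : class_C 3 jet_slab first_integral_z.
  exact: (class_CD oU (class_CB oU (class_CB oU cZ (class_CM oU cP cX)) (class_CM oU cQ cY))
    (class_CM oU (cc 2^-1) (class_CD oU (class_CD oU (class_CM oU (class_CM oU crs cX) cX)
      (class_CM oU (class_CM oU (class_CM oU (cc 2) cS) cX) cY)) (class_CM oU (class_CM oU cts cY) cY)))).
have fp : class_C 3 jet_slab first_integral_p.
  exact: (class_CB oU (class_CB oU cP (class_CM oU crs cX)) (class_CM oU cS cY)).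
have fq : class_C 3 jet_slab first_integral_q.
  exact: (class_CB oU (class_CB oU cQ (class_CM oU cS cX)) (class_CM oU cts cY)).
move: j; apply: ord4P.
- by apply: (class_C_eq oU) fz => u _; rewrite mxE.
- by apply: (class_C_eq oU) fp => u _; rewrite mxE.
- by apply: (class_C_eq oU) fq => u _; rewrite mxE.
- by apply: (class_C_eq oU) cS => u _; rewrite mxE.
Qed.

Let is_derive_coord i (u v : J) : is_derive u v (fun u : J => u 0 i) (v 0 i).
Proof.
have d : derivable id u v by exact: derivable_id.
have := derive_mx d; rewrite derive_id => /matrixP /(_ 0 i); rewrite [RHS]mxE => e.
apply: DeriveDef; last exact: esym e.
apply: diff_derivable; exact: differentiable_coord.
Qed.

Lemma derive_leaf u v : jet_slab u ->
  let x := cx u in let y := cy u in let s := cs u in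
  v *m 'J leaf u = \row_j [::
    theta_z u v - x * theta_p r u v - y * theta_q t u v
      + 2^-1 * (derive1 r s * x * x + 2 * x * y + derive1 t s * y * y) * cs v;
    theta_p r u v - (derive1 r s * x + y) * cs v;
    theta_q t u v - (x + derive1 t s * y) * cs v;
    cs v]`_j.
Proof.
move=> Uu x y s.
have dl := class_C_diff class_C_leaf Uu.
rewrite -deriveEjacobian // derive_mx; last exact: diff_derivable.
have dX : is_derive u v (cx : J -> R) (cx v) := is_derive_coord _ u v.
have dY : is_derive u v (cy : J -> R) (cy v) := is_derive_coord _ u v.
have dZ : is_derive u v (cz : J -> R) (cz v) := is_derive_coord _ u v.
have dP : is_derive u v (cp : J -> R) (cp v) := is_derive_coord _ u v.
have dQ : is_derive u v (cq : J -> R) (cq v) := is_derive_coord _ u v.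
have dS : is_derive u v (cs : J -> R) (cs v) := is_derive_coord _ u v.
have dfun (f : R -> R) : class_C 3 S f -> is_derive u v (fun u => f (cs u)) (derive1 f s * cs v).
  move=> cf; apply: DeriveDef.
    by apply: diff_derivable; exact: class_C_diff (cfun cf) Uu.
  rewrite -[X in derive X]/(f \o (cs : J -> R)) derive_comp1.
  - by rewrite -derive1E; congr (_ * _); exact: derive_val.
  - exact: class_C_diff (ccoord 1 _) Uu.
  - exact: class_C_diff cf Uu.
have dr := dfun _ cr; have dt := dfun _ ct.
have D (f : J -> R) df i j : (fun u => leaf u i j) = f -> is_derive u v f df ->
    (\matrix_(i, j) 'D_v (fun t => leaf t i j) u) i j = df.
  by move=> e d; rewrite mxE e; exact: derive_val.
apply/matrixP => i; apply: ord4P; rewrite [RHS]mxE /=.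
- apply: (D first_integral_z); first by apply/funext => w; rewrite mxE.
  rewrite /first_integral_z; apply: is_derive_eq.
  rewrite /GRing.scale /= /theta_z /theta_p /theta_q -/x -/y -/s.
  move: (cx v) (cy v) (cz v) (cp v) (cq v) (cs v) (cp u) (cq u)
    => vx vy vz vp vq vs p q.
  by move: (r s) (t s) (derive1 r s) (derive1 t s) => a b a' b'; field.
- apply: (D first_integral_p); first by apply/funext => w; rewrite mxE.
  rewrite /first_integral_p; apply: is_derive_eq.
  rewrite /GRing.scale /= /theta_z /theta_p /theta_q -/x -/y -/s.
  move: (cx v) (cy v) (cz v) (cp v) (cq v) (cs v) (cp u) (cq u)
    => vx vy vz vp vq vs p q.
  by move: (r s) (t s) (derive1 r s) (derive1 t s) => a b a' b'; field.
- apply: (D first_integral_q); first by apply/funext => w; rewrite mxE.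
  rewrite /first_integral_q; apply: is_derive_eq.
  rewrite /GRing.scale /= /theta_z /theta_p /theta_q -/x -/y -/s.
  move: (cx v) (cy v) (cz v) (cp v) (cq v) (cs v) (cp u) (cq u)
    => vx vy vz vp vq vs p q.
  by move: (r s) (t s) (derive1 r s) (derive1 t s) => a b a' b'; field.
- apply: (D cs) => //; by apply/funext => w; rewrite mxE.
Qed.

Lemma leaf_kernel u v : jet_slab u -> v *m 'J leaf u = 0 <-> Hplus r t u v.
Proof.
move=> Uu; rewrite derive_leaf //; split=> [/rowP e|[a [b ->]]].
  have := e i3; rewrite !mxE /= => e3.
  have := e i2; rewrite !mxE /= e3 mulr0 subr0 => e2.
  have := e i1; rewrite !mxE /= e3 mulr0 subr0 => e1.
  have := e i0; rewrite !mxE /= e1 e2 e3 !mulr0 !subr0 addr0 => e0.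
  exists (cx v), (cy v).
  move: e0 e1 e2 e3; rewrite /theta_z /theta_p /theta_q => e0 e1 e2 e3.
  apply/rowP; apply: ord6P; rewrite !mxE /= ?(mulr1, mulr0, addr0, add0r) //.
  - by apply/eqP; rewrite -subr_eq0 opprD addrA -[X in _ - X - _]mulrC -[X in _ - _ - X]mulrC -[X in _ == X]e0.
  - by apply/eqP; rewrite -subr_eq0 opprD addrA -[X in _ - X - _]mulrC -[X in _ - _ - X]mulrC -[X in _ == X]e1.
  - by apply/eqP; rewrite -subr_eq0 opprD addrA -[X in _ - X - _]mulrC -[X in _ - _ - X]mulrC -[X in _ == X]e2.
have s0 : cs (a *: Dx r u + b *: Dy t u) = 0.
  by rewrite /cs !mxE /= !mulr0 addr0.
have z0 : theta_z u (a *: Dx r u + b *: Dy t u) = 0.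
  rewrite /theta_z /cz /cx /cy !mxE /= ?(mulr1, mulr0, addr0, add0r).
  by rewrite -/(cp u) -/(cq u); ring.
have p0 : theta_p r u (a *: Dx r u + b *: Dy t u) = 0.
  rewrite /theta_p /cp /cx /cy !mxE /= ?(mulr1, mulr0, addr0, add0r).
  by ring.
have q0 : theta_q t u (a *: Dx r u + b *: Dy t u) = 0.
  rewrite /theta_q /cq /cx /cy !mxE /= ?(mulr1, mulr0, addr0, add0r).
  by ring.
rewrite s0 z0 p0 q0 !mulr0 !subr0 addr0.
by apply/rowP; apply: ord4P; rewrite !mxE.
Qed.

(** The metric is the pullback of plane_wave, its restriction to x = y = 0: the
    terms with x or y cancel. *)
Lemma leaf_descends h : descends_to r t h jet_slab leaf (plane_wave (derive1 t) (derive1 r) h).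
Proof.
move=> u Uu v w; rewrite !derive_leaf //.
set A := \row_j _; set B := \row_j _.
have q4 (M : 'M[R]_4) : (A *m M *m B^T) 0 0 = \sum_i \sum_j A 0 i * M i j * B 0 j.
  rewrite mxE exchange_big; apply: eq_bigr => j _.
  by rewrite [(A *m M) 0 j]mxE [B^T j 0]mxE big_distrl.
rewrite q4 /plane_wave [leaf u 0 i3]mxE /= sum4 !sum4 !mxE /=.
rewrite /jet_form /sym_prod.
move: (theta_z u v) (theta_p r u v) (theta_q t u v) (cs v) => z p q s.
move: (theta_z u w) (theta_p r u w) (theta_q t u w) (cs w) => z' p' q' s'.
move: (cx u) (cy u) (expR _) (derive1 r _) (derive1 t _) => x y e a b.
by field.
Qed.

Lemma leaf_chart : leaf_space_chart r t jet_slab (slab S) leaf.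
Proof.
split.
- by split; [exact: oU|exact: open_slab].
- exact: leaf_image.
- exact: class_C_leaf.
- by move=> u Uu v; exact: leaf_kernel.
- by move=> u Uu; exact: leaf_connected.
Qed.

(** Sufficiency of the ODE. *)
Lemma h_ode_flat (h : R -> R) : class_C 2 S h ->
  (forall s, S s -> 1 - derive1 r s * derive1 t s != 0) ->
  (forall s, S s -> h_ode r t h s) -> ricci_flat_on_leaf_space r t h S.
Proof.
move=> ch D0 ode u0 Su0.
have cr1 := class_C_derive1 cr; have ct1 := class_C_derive1 ct.
exists jet_slab, (slab S), leaf, (plane_wave (derive1 t) (derive1 r) h); split.
- by split.
- exact: leaf_chart.
- exact: plane_wave_pseudo oS ct1 cr1 ch D0.
- exact: leaf_descends.
move=> w Ow; apply/matrixP => j k.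
rewrite (ricci_plane_wave oS ct1 cr1 ch D0 Ow) [RHS]mxE.
have dr := class_C_is_derive cr1 Ow; have dt := class_C_is_derive ct1 Ow.
by rewrite ((h_odeE h dr dt).1 (ode _ Ow)) mulr0 mul0rn.
Qed.

End Chart.

(** * Solvability of the equation for h *)

Section Existence.
Context {R : realType}.

(** The substitution h = - ln w makes the ODE linear. With D = 1 - r't' it becomes
    the system w' = D v, v' = b w, where - D b is the term of the ODE that is free
    of h. *)
Lemma h_ode_solvable (I : set R) (r t : R -> R) (s0 : R) : open I -> I s0 ->
  class_C 3 I r -> class_C 3 I t ->
  (forall s, I s -> 1 - derive1 r s * derive1 t s != 0) ->
  exists (S : set R) (h : R -> R),
    [/\ open S, S `<=` I, S s0, class_C 2 S h & forall s, S s -> h_ode r t h s].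
Proof.
move=> oI Is0 cr ct D0.
pose u : R -> R := derive1 t; pose v : R -> R := derive1 r.
pose u1 : R -> R := derive1 u; pose v1 : R -> R := derive1 v.
pose u2 : R -> R := derive1 u1; pose v2 : R -> R := derive1 v1.
pose D (s : R) : R := 1 - v s * u s.
(* The term of the ODE that is free of h is N / (8 D^2). *)
pose N (s : R) : R := 2 * (v2 s * u s + u2 s * v s) * D s + 2 * v1 s * u1 s
       + 4 * v s * u s * v1 s * u1 s + 3 * (u s * u s) * (v1 s * v1 s)
       + 3 * (v s * v s) * (u1 s * u1 s).
pose b (s : R) : R := - (N s / (8 * (D s * D s)) / D s).
have cu : class_C 2 I u by exact: class_C_derive1 ct.
have cv : class_C 2 I v by exact: class_C_derive1 cr.
have cu1 : class_C 1 I u1 by exact: class_C_derive1 cu.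
have cv1 : class_C 1 I v1 by exact: class_C_derive1 cv.
have cu2 : class_C 0 I u2 by exact: class_C_derive1 cu1.
have cv2 : class_C 0 I v2 by exact: class_C_derive1 cv1.
have cc k c : class_C k I (fun _ : R => c : R) by exact: class_C_cst.
have cD : class_C 2 I D by exact: (class_CB oI (cc 2 1) (class_CM oI cv cu)).
have cb : class_C 0 I b.
  have xu := class_CW (class_CW cu); have xv := class_CW (class_CW cv).
  have xu1 := class_CW cu1; have xv1 := class_CW cv1; have xD := class_CW (class_CW cD).
  have cN : class_C 0 I N.
    apply: (class_CD oI (class_CD oI (class_CD oI (class_CD oI _ _) _) _) _).
    - exact: (class_CM oI (class_CM oI (cc _ _) (class_CD oI (class_CM oI cv2 xu) (class_CM oI cu2 xv))) xD).
    - exact: (class_CM oI (class_CM oI (cc _ _) xv1) xu1).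
    - exact: (class_CM oI (class_CM oI (class_CM oI (class_CM oI (cc _ _) xv) xu) xv1) xu1).
    - exact: (class_CM oI (class_CM oI (cc _ _) (class_CM oI xu xu)) (class_CM oI xv1 xv1)).
    - exact: (class_CM oI (class_CM oI (cc _ _) (class_CM oI xv xv)) (class_CM oI xu1 xu1)).
  apply: (class_CN oI (class_CM oI (class_CM oI cN _) (class_CV oI D0 xD))).
  apply: (class_CV oI _ (class_CM oI (cc _ 8) (class_CM oI xD xD))) => s Is.
  by rewrite !mulf_neq0 // ?pnatr_eq0 // D0.
have [S [w [z [[oS Ss0] SI w0 dw dz]]]] := linear_system oI Is0 (class_CW (class_CW cD)) cb.
pose k (s : R) : R := - (D s * z s / w s).
pose h (s : R) : R := - ln (w s).
have wn0 s : w s != 0 by rewrite lt0r_neq0.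
have dh s : S s -> is_derive s 1 h (k s).
  move=> Ss; have dln := is_derive1_comp (is_derive1_ln (w0 s)) (dw s Ss).
  by have := is_deriveN dln; rewrite [(w s)^-1 * _]mulrC.
have cw0 : class_C 0 S w.
  exact: class_C0_of_is_derive dw.
have cz : class_C 1 S z.
  apply: (class_C_of_is_derive oS dz).
  exact: (class_CM oS (class_C_subset SI cb) cw0).
have cw : class_C 1 S w.
  apply: (class_C_of_is_derive oS dw).
  exact: (class_CM oS (class_C_subset SI (class_CW (class_CW cD))) (class_CW cz)).
have ck : class_C 1 S k.
  apply: (class_CN oS (class_CM oS (class_CM oS (class_C_subset SI (class_CW cD)) cz) _)).
  by apply: (class_CV oS _ cw) => s _.
exists S, h; split; [exact: oS|exact: SI|exact: Ss0| |].
  exact: (class_C_of_is_derive oS dh ck).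
move=> s Ss; have Is := SI s Ss.
have du := class_C_is_derive cu Is; have dv := class_C_is_derive cv Is.
apply: (h_odeE h dv du).2.
have hE x : S x -> derive1 h x = k x.
  by move=> Sx; rewrite derive1E; have [] := dh x Sx.
have dD : is_derive s 1 D (- (v1 s * u s + v s * u1 s)).
  rewrite /D; apply: is_derive_eq; rewrite /GRing.scale /=.
  rewrite -/(u1 s) -/(v1 s); move: (u s) (v s) (u1 s) (v1 s) => x1 x2 x3 x4; ring.
have dk : derive1 (derive1 h) s =
   - ((- (v1 s * u s + v s * u1 s) * z s + D s * (b s * w s)) / w s
      - D s * z s * (D s * z s) / (w s * w s)).
  have -> : derive1 (derive1 h) s = derive1 k s.
    by rewrite !derive1E; apply: near_eq_derive; apply: (open_near oS Ss).
  have dkk := is_deriveN (is_deriveM (is_deriveM dD (dz s Ss)) (is_deriveV (wn0 s) (dw s Ss))).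
  rewrite derive1E; apply: etrans (@derive_val _ _ _ _ _ _ _ dkk) _.
  rewrite /GRing.scale /= -[(D * z) s]/(D s * z s).
  move: (D s) (v s) (u s) (v1 s) (u1 s) (z s) (b s) (w s) (wn0 s).
  by move=> x1 x2 x3 x4 x5 x6 x7 x8 x80; field.
rewrite dk (hE s Ss).
change (k s ^+ 2 - (u1 s * v s + u s * v1 s) / D s * k s
  + (2 * (v2 s * u s + u2 s * v s) * D s + 2 * v1 s * u1 s + 4 * v s * u s * v1 s * u1 s
     + 3 * u s ^+ 2 * v1 s ^+ 2 + 3 * v s ^+ 2 * u1 s ^+ 2) / (8 * D s ^+ 2)
  - - ((- (v1 s * u s + v s * u1 s) * z s + D s * (b s * w s)) / w s
      - D s * z s * (D s * z s) / (w s * w s)) = 0).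
have : D s != 0 := D0 s Is.
rewrite /k /b /N /D.
move: (v s) (u s) (v1 s) (u1 s) (v2 s) (u2 s) (z s) (w s) (wn0 s).
by move=> x2 x3 x4 x5 x6 x7 x8 x9 x90 x10; field; rewrite x90.
Qed.

End Existence.

Unset Implicit Arguments.

Theorem theorem8p8 (R : realType) (I : set R) (r t : R -> R)
  (openI : open I)
  (C3r : class_C 3 I r) (C3t : class_C 3 I t)
  (rt_neq0 : forall s, I s -> 1 - derive1 r s * derive1 t s != 0) :
  (forall s0, I s0 ->
     exists (S : set R) (h : R -> R),
       [/\ open S, S `<=` I, S s0, class_C 2 S h &
           ricci_flat_on_leaf_space r t h S])
  /\
  (forall (S : set R) (h : R -> R),
     open S -> S `<=` I -> class_C 2 S h ->
     ricci_flat_on_leaf_space r t h S ->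
     forall s, S s -> h_ode r t h s).
Proof.
split=> [s0 Is0|S h oS SI ch flat s Ss].
  have [S [h [oS SI Ss0 ch ode]]] := h_ode_solvable openI Is0 C3r C3t rt_neq0.
  exists S, h; split; [exact: oS|exact: SI|exact: Ss0|exact: ch|].
  exact: (h_ode_flat oS (class_C_subset SI C3r) (class_C_subset SI C3t) ch (fun s Ss => rt_neq0 s (SI s Ss)) ode).
exact: (flat_h_ode oS (class_C_derive1 (class_C_subset SI C3t)) (class_C_derive1 (class_C_subset SI C3r))
  ch (fun s Ss => rt_neq0 s (SI s Ss)) flat Ss).
Qed.
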